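(* Let $\mathbf{z}=[\mathbf{y}^\top\ \mathbf{x}^\top]^\top$ be a zero-mean Gaussian, stationary, periodic, reciprocal process of order $n$ on $[1,N]$ with positive definite covariance matrix, where $\mathbf{y}$ is $m$-dimensional with components $y_1,\dots,y_m$ and $\mathbf{x}$ is $l$-dimensional, and let $\Omega\subseteq\{(i,j): i,j=1,\dots,m\}$ be a set of pairs containing all $(i,i)$, $i=1,\dots,m$, with complement $\Omega^c$ in $\{(i,j): i,j=1,\dots,m\}$. Then the following two conditions are equivalent: (a) for every $t_1,t_2\in\{1,\dots,N\}$ and every $(i,j)\in\Omega^c$, the random variables $y_i(t_1)$ and $y_j(t_2)$ are conditionally independent given $$\{\,y_h(s),\ h\ne i,j,\ s=1,\dots,N;\quad y_i(s_1),\ s_1\ne t_1;\quad y_j(s_2),\ s_2\ne t_2;\quad \mathbf{x}\,\};$$ (b) for every $t_1,t_2\in\{1,\dots,N\}$ and every $(i,j)\in\Omega^c$, the random variables $y_i(t_1)$ and $y_j(t_2)$ are conditionally independent given $$\{\,y_h(s),\ h\ne i,j,\ s=1,\dots,N;\quad \mathbf{x}\,\}.$$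
   Context: $m,l,n,N$ are positive integers with $N$ even and $N>2n$. An $m$-dimensional process on $[1,N]$ is identified with the random vector $\mathbf{y}=[y_1(1)\,\dots\,y_m(1)\,\dots\,y_1(N)\,\dots\,y_m(N)]^\top\in\mathbb{R}^{mN}$; conditioning on $\mathbf{x}$ means conditioning on all the random variables $x_j(s)$, $j=1,\dots,l$, $s=1,\dots,N$. The indices $s,s_1,s_2$ range over $\{1,\dots,N\}$. A process on $[1,N]$ is stationary periodic (it extends to a wide-sense stationary $N$-periodic process on $\mathbb{Z}$) iff its covariance matrix is symmetric block-circulant. A process is reciprocal of order $n$ on $[1,N]$ if, for all $t_1,t_2\in[1,N]$, the random variables of the process in the interval $(t_1,t_2)\subset[1,N]$ are conditionally independent of those in the complement $(t_1,t_2)^c$ given the $2n$ boundary values at times $t_1-n+1,\dots,t_1,t_2,\dots,t_2+n-1$ (times modulo $N$). Partition the inverse covariance (concentration) matrix of $[\mathbf{y}^\top\ \mathbf{x}^\top]^\top$ as $\boldsymbol{\Sigma}_{\mathbf{z}}^{-1}=\begin{bmatrix}\mathbf{S}&\mathbf{A}\\ \mathbf{A}^\top&\mathbf{R}\end{bmatrix}$ with $\mathbf{S}\in\mathbb{R}^{mN\times mN}$, and set $\mathbf{L}=\mathbf{A}\mathbf{R}^{-1}\mathbf{A}^\top$. It is a standing assumption that $\mathbf{S}$ and $\mathbf{L}$ are symmetric block-circulant with $m\times m$ blocks and banded of bandwidth $n$, i.e. of the form $\mathrm{circ}\{S_0,\dots,S_n,0,\dots,0,S_n^\top,\dots,S_1^\top\}$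 (where $\mathrm{circ}\{\cdot\}$ denotes the block-circulant matrix with the listed blocks as first block-column). *)

(* Defs.v *)
(* MathComp / MathComp-Analysis. *)
From HB Require Import structures.
From mathcomp Require Import all_boot all_order all_algebra.
From mathcomp Require Import all_classical all_reals all_analysis.

Set Implicit Arguments.
Unset Strict Implicit.
Unset Printing Implicit Defensive.

Import Order.TTheory GRing.Theory Num.Theory.
Import numFieldNormedType.Exports.

Local Open Scope classical_set_scope.
Local Open Scope ring_scope.

Section ConditionalIndependence.
Context {d : measure_display} {T : measurableType d} {R : realType}.
Variable P : probability T R.

Definition sigma_of (I : Type) (X : I -> {RV P >-> R}) (D : set I) :
    set (set T) :=
  <<s \bigcup_(k in D) preimage_set_system setT (X k) measurable >>.

(* p is a version of the conditional probability P(E | G). *)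
Definition is_cond_prob (G : set (set T)) (E : set T) (p : T -> R) : Prop :=
  [/\ (forall B : set R, measurable B -> G (p @^-1` B)),
      P.-integrable setT (EFin \o p) &
      forall C, G C -> (\int[P]_(w in C) (p w)%:E)%E = P (E `&` C)].

(* P(E1 /\ E2 | G) = P(E1 | G) P(E2 | G) almost surely. Versions of conditional
   probabilities exist and are unique up to null sets, so asking for one good
   pair of versions is the same as asking it of every pair. *)
Definition cond_indep_sigma (F1 F2 G : set (set T)) : Prop :=
  forall E1 E2, F1 E1 -> F2 E2 ->
    exists p1 p2 : T -> R,
      [/\ is_cond_prob G E1 p1, is_cond_prob G E2 p2 &
          is_cond_prob G (E1 `&` E2) (fun w => p1 w * p2 w)].

(* (X_k, k in D1) and (X_k, k in D2) are conditionally independent given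
   (X_k, k in D). *)
Definition cond_indep (I : Type) (X : I -> {RV P >-> R}) (D1 D2 D : set I) :
    Prop :=
  cond_indep_sigma (sigma_of X D1) (sigma_of X D2) (sigma_of X D).

End ConditionalIndependence.

Section GaussianVectors.
Context {d : measure_display} {T : measurableType d} {R : realType}.
Variable P : probability T R.

(* The product rule over subfamilies is included: take B i = setT. *)
Definition std_normal_vector (k : nat) (w : 'I_k -> {RV P >-> R}) : Prop :=
  (forall i (B : set R), measurable B -> P (w i @^-1` B) = normal_prob 0 1 B) /\
  (forall B : 'I_k -> set R, (forall i, measurable (B i)) ->
     P (\bigcap_(i in setT) (w i @^-1` B i))
     = (\prod_(i < k) P (w i @^-1` B i))%E).

(* A Gaussian vector is an affine image of a vector of independent standard
   normal variables. Letting these live on the space of v is no restriction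
   when the covariance Q of v is nonsingular: take w = Q^(-1/2) (v - mu). *)
Definition gaussian_vector (k : nat) (v : 'rV[{RV P >-> R}]_k) : Prop :=
  exists (r : nat) (w : 'I_r -> {RV P >-> R}) (B : 'M[R]_(k, r)) (mu : 'rV[R]_k),
    std_normal_vector w /\
    forall p (om : T), v 0 p om = mu 0 p + \sum_(i < r) B p i * w i om.

Definition covmx (k : nat) (v : 'rV[{RV P >-> R}]_k) : 'M[R]_k :=
  \matrix_(p, q) fine (covariance P (v 0 p) (v 0 q)).

End GaussianVectors.

Definition posdefmx (R : realType) (k : nat) (M : 'M[R]_k) : Prop :=
  forall u : 'rV[R]_k, u != 0 -> 0 < (u *m M *m u^T) 0 0.

(* A process on [1,N] with components indexed by C is a family
   z : C -> 'I_N -> {RV P >-> R}; the ordinal t stands for the time t + 1. *)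
Section Processes.
Context {d : measure_display} {T : measurableType d} {R : realType}.
Variable P : probability T R.

Definition wide_sense_stationary (C : Type) (u : C -> int -> {RV P >-> R}) :
    Prop :=
  [/\ (forall c t, (u c t : T -> R) \in Lfun P 2%:E),
      (forall c s t, ('E_P[u c s] = 'E_P[u c t])%E) &
      forall c c' s t h, covariance P (u c (s + h)) (u c' (t + h))
                         = covariance P (u c s) (u c' t)].

Definition stationary_periodic (C : Type) (N : nat)
    (z : C -> 'I_N -> {RV P >-> R}) : Prop :=
  exists u : C -> int -> {RV P >-> R},
    [/\ (forall c (t : 'I_N), u c (t.+1)%:Z = z c t),
        (forall c t, u c (t + N%:Z) = u c t) &
        wide_sense_stationary u].

(* The times t1-n+1, ..., t1, t2, ..., t2+n-1, modulo N. *)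
Definition boundary (N n : nat) (t1 t2 : 'I_N) : set 'I_N :=
  [set t | exists2 k : nat, (k < n)%N &
             (t + k = t1 %[mod N])%N \/ (t = t2 + k %[mod N])%N].

Definition open_interval (N : nat) (t1 t2 : 'I_N) : set 'I_N :=
  [set t | (t1 < t < t2)%N].

(* Reading (t1, t2) as the arc that runs cyclically from t1 to t2 gives the
   same notion: the statement for an arc through N is the statement for the
   ordinary interval (t2+n-1, t1-n+1), which has the same boundary, and both
   are trivial if that interval is empty. *)
Definition reciprocal (C : Type) (n N : nat) (z : C -> 'I_N -> {RV P >-> R}) :
    Prop :=
  forall t1 t2 : 'I_N,
    cond_indep (fun k : C * 'I_N => z k.1 k.2)
      [set k | open_interval t1 t2 k.2]
      [set k | ~ open_interval t1 t2 k.2]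
      [set k | boundary n t1 t2 k.2].

Definition joint (m l N : nat)
    (y : 'I_m -> 'I_N -> {RV P >-> R}) (x : 'I_l -> 'I_N -> {RV P >-> R})
    (c : 'I_m + 'I_l) : 'I_N -> {RV P >-> R} :=
  match c with inl i => y i | inr j => x j end.

(* [y_1(1) ... y_m(1) ... y_1(N) ... y_m(N)] *)
Definition stack (m N : nat) (y : 'I_m -> 'I_N -> {RV P >-> R}) :
    'rV[{RV P >-> R}]_(N * m) :=
  mxvec (\matrix_(t < N, i < m) y i t).

Definition stack2 (m l N : nat)
    (y : 'I_m -> 'I_N -> {RV P >-> R}) (x : 'I_l -> 'I_N -> {RV P >-> R}) :
    'rV[{RV P >-> R}]_(N * m + N * l) :=
  row_mx (stack y) (stack x).

End Processes.

Section ConcentrationBlocks.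
Context {R : realType} {p q : nat}.
Variable Sigma : 'M[R]_(p + q).

Definition Sblock : 'M[R]_p := ulsubmx (invmx Sigma).
Definition Ablock : 'M[R]_(p, q) := ursubmx (invmx Sigma).
Definition Rblock : 'M[R]_q := drsubmx (invmx Sigma).
Definition Lblock : 'M[R]_p := Ablock *m invmx Rblock *m Ablock^T.

End ConcentrationBlocks.

Definition blockmx (R : realType) (N m : nat) (M : 'M[R]_(N * m))
    (t s : 'I_N) : 'M[R]_m :=
  \matrix_(i, j) M (mxvec_index t i) (mxvec_index s j).

(* M = circ {Q 0, ..., Q (N - 1)}: block (t, s) is Q ((t - s) mod N). *)
Definition is_circ (R : realType) (N m : nat) (Q : nat -> 'M[R]_m)
    (M : 'M[R]_(N * m)) : Prop :=
  forall t s : 'I_N, blockmx M t s = Q ((t + (N - s)) %% N)%N.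

(* M = circ {S_0, ..., S_n, 0, ..., 0, S_n^T, ..., S_1^T}, for N > 2 n *)
Definition sym_banded_circ (R : realType) (n N m : nat) (M : 'M[R]_(N * m)) :
    Prop :=
  M^T = M /\
  exists S_ : nat -> 'M[R]_m,
    is_circ (fun k => if (k <= n)%N then S_ k
                      else if (N - n <= k)%N then (S_ (N - k)%N)^T
                      else 0) M.

Section ConditioningSets.
Variables m l N : nat.

(* y_h(s) for h <> i, j; y_i(s) for s <> t1; y_j(s) for s <> t2; all of x *)
Definition all_but_points (i j : 'I_m) (t1 t2 : 'I_N) :
    set (('I_m + 'I_l) * 'I_N) :=
  [set k | match k with
           | (inl h, s) => [\/ (h <> i /\ h <> j), (h = i /\ s <> t1)
                             | (h = j /\ s <> t2)]
           | (inr _, _) => True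
           end].

(* y_h(s) for h <> i, j; all of x *)
Definition all_but_components (i j : 'I_m) : set (('I_m + 'I_l) * 'I_N) :=
  [set k | match k with
           | (inl h, _) => h <> i /\ h <> j
           | (inr _, _) => True
           end].

End ConditioningSets.

(* Main.v *)
Require Import Defs.
From HB Require Import structures.
From mathcomp Require Import all_boot all_order all_algebra.
From mathcomp Require Import all_classical all_reals all_analysis.
From mathcomp Require Import measurable_realfun ring lra.

Set Implicit Arguments.
Unset Strict Implicit.
Unset Printing Implicit Defensive.

Import Order.TTheory GRing.Theory Num.Theory.
Import numFieldNormedType.Exports.

Local Open Scope classical_set_scope.
Local Open Scope ring_scope.

(* Let G be the covariance matrix of z, let D be a set of variables and a, b
   two variables outside D.  By rotation invariance of the standard normal law,
   an LQ decomposition writes the variables of D as an invertible affine image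
   of independent standard normals v_1, ..., v_k, and z_a = Z_a + s v_(k+1),
   z_b = Z_b + c v_(k+1) + t v_(k+2), where Z_a, Z_b are functions of D and
   s, t <> 0.  Integrating out (v_(k+1), v_(k+2)) gives explicit versions of the
   conditional probabilities given D.  They factor if c = 0, while for c <> 0
   the events {s z_a > 0} and {c z_b > 0} are strictly positively correlated
   given D.  Hence a and b are conditionally independent given D iff c = 0, that
   is, iff the residual of z_a after regression on D is uncorrelated with z_b.

   If D is the complement of a disjoint union of I and J, then all a in I and b
   in J have this property iff the I x J block of G^-1 vanishes.  Condition (a)
   is the case of singletons I and J, condition (b) that of the whole processes
   y_i and y_j, so both say that G^-1 has zero entries between y_i and y_j. *)

(** * Rotation invariance of the normal law *)

Section NormalRotation.
Context {R : realType}.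
Local Notation mu := (@lebesgue_measure R).
Local Notation phi := (@normal_prob R 0 1).
Local Notation pdf := (@normal_pdf R 0 1).

Lemma measurable_linear2 (a b : R) :
  measurable_fun [set: R * R] (fun p => a * p.1 + b * p.2).
Proof. by apply: measurable_funD; apply: measurable_funM. Qed.

(** The Radon-Nikodym derivative of the normal law and [pdf] have the same integral over every
    measurable set, so they agree almost everywhere, and [pdf] can replace the derivative in the
    change of variables. *)
Lemma ge0_integral_normal_prob (f : R -> \bar R) :
  measurable_fun [set: R] f -> (forall x, 0 <= f x)%E ->
  (\int[phi]_x f x = \int[mu]_x (f x * (pdf x)%:E))%E.
Proof.
move=> mf f0.
have dom := normal_prob_dominates (0 : R) 1.
have mpdf : measurable_fun [set: R] (EFin \o pdf).
  by apply/measurable_EFinP; exact: measurable_normal_pdf.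
rewrite -(Radon_Nikodym_SigmaFinite.change_of_variables dom)//.
apply: ae_eq_integral => //.
- apply: emeasurable_funM => //.
  exact: measurable_int (Radon_Nikodym_SigmaFinite.f_integrable dom).
- exact: emeasurable_funM.
- suff : ae_eq mu [set: R] (Radon_Nikodym_SigmaFinite.f phi mu) (EFin \o pdf).
    by apply: filterS => x h _ /=; rewrite h.
  apply: integral_ae_eq => //.
  + exact: Radon_Nikodym_SigmaFinite.f_integrable.
  + by move=> E _ mE; rewrite -Radon_Nikodym_SigmaFinite.f_integral.
Qed.

(** The image of Lebesgue measure under [x |-> a * x + b], scaled by [|a|], gives each half-open
    interval its length, hence is Lebesgue measure. For [a < 0] the preimage of an interval is
    closed on the other side, which does not affect its length. *)
Lemma ge0_integral_affine (a b : R) (f : R -> \bar R) : a != 0 ->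
  measurable_fun [set: R] f -> (forall x, 0 <= f x)%E ->
  (\int[mu]_x f (a * x + b)%R = `|a|^-1%:E * \int[mu]_x f x)%E.
Proof.
move=> a0 mf f0.
have a_gt0 : 0 < `|a| by rewrite normr_gt0.
pose g : measurableTypeR R -> measurableTypeR R := fun x => a * x + b.
have mg : measurable_fun setT g.
  by apply: measurable_funD => //; apply: measurable_funM.
have mE A : measurable A ->
    mu A = mscale (NngNum (ltW a_gt0)) (pushforward mu g) A.
  apply: lebesgue_measure_unique => // _ [[u v]] _ <-.
  rewrite -[RHS]/(`|a|%:E * mu (g @^-1` `]u, v]))%E.
  rewrite lebesgue_measure_itv/= lte_fin.
  have := a0; rewrite neq_lt => /orP[a_neg|a_pos]; last first.
  - rewrite gtr0_norm//.
    have -> : g @^-1` `]u, v] = `](u - b) / a, (v - b) / a]%classic.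
      by apply/seteqP; split => x /=; rewrite !in_itv/= /g
        ltr_pdivrMr// ler_pdivlMr// ltrBlDr lerBrDr mulrC.
    rewrite lebesgue_measure_itv/= lte_fin ltr_pM2r ?invr_gt0// ltrD2r.
    case: ifP => _; last by rewrite mule0.
    by rewrite -!EFinD -EFinM; congr (_%:E); field; rewrite gt_eqF.
  - rewrite ltr0_norm//.
    have -> : g @^-1` `]u, v] = `[(v - b) / a, (u - b) / a[%classic.
      by apply/seteqP; split => x /=; rewrite !in_itv/= /g
        ltr_ndivlMr// ler_ndivrMr// ltrBlDr lerBrDr mulrC andbC.
    rewrite lebesgue_measure_itv/= lte_fin ltr_nM2r ?invr_lt0// ltrD2r.
    case: ifP => _; last by rewrite mule0.
    by rewrite -!EFinD -EFinM; congr (_%:E); field; rewrite lt_eqF.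
have -> : (\int[mu]_x f (a * x + b)%R = \int[pushforward mu g]_x f x)%E.
  by rewrite ge0_integral_pushforward.
rewrite [in RHS](eq_measure_integral (D := setT)
  (mscale (NngNum (ltW a_gt0)) (pushforward mu g))); last first.
  by move=> A mA _; exact: mE.
rewrite ge0_integral_mscale//= muleA -EFinM mulVf ?mul1e//.
by rewrite gt_eqF.
Qed.

Lemma normal_probE (A : set R) : measurable A ->
  phi A = (\int[mu]_x (\1_A x * pdf x)%:E)%E.
Proof.
move=> mA; rewrite /normal_prob integral_mkcond.
apply: eq_integral => x _; rewrite patchE indicE.
by case: ifPn => _; rewrite ?mul1r ?mul0r.
Qed.

Lemma normal_pdf01E x : pdf x = normal_peak 1 * expR (- (x ^+ 2) / 2).
Proof.
by rewrite normal_pdfE ?oner_eq0// /normal_fun subr0 expr1n.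
Qed.

Lemma normal_pdf_rotation (c s x y : R) : c ^+ 2 + s ^+ 2 = 1 ->
  pdf (c * x - s * y) * pdf (s * x + c * y) = pdf x * pdf y.
Proof.
move=> cs; rewrite !normal_pdf01E.
rewrite mulrACA -expRD [RHS]mulrACA -expRD; congr (_ * expR _).
have -> : - (c * x - s * y) ^+ 2 / 2 + - (s * x + c * y) ^+ 2 / 2 =
  (c ^+ 2 + s ^+ 2) * (- x ^+ 2 / 2 + - y ^+ 2 / 2) by field.
by rewrite cs mul1r.
Qed.

Lemma ge0_integral_indic_pdf (a : R) (A : set R) : 0 <= a -> measurable A ->
  (\int[mu]_x (a * (\1_A x * pdf x))%:E = a%:E * phi A)%E.
Proof.
move=> a0 mA; rewrite normal_probE//.
have mf : measurable_fun [set: R] (fun x => (\1_A x * pdf x)%:E).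
  apply/measurable_EFinP; apply: measurable_funM => //.
  exact: measurable_normal_pdf.
transitivity (\int[mu]_x (a%:E * (\1_A x * pdf x)%:E))%E.
  by apply: eq_integral => x _; rewrite EFinM.
apply: (ge0_integralZl mu measurableT mf); last by rewrite lee_fin.
by move=> x _; rewrite lee_fin mulr_ge0// normal_pdf_ge0.
Qed.

Lemma lebesgue_fubiniZ (a : R) (h : R -> R -> R) :
  0 <= a -> (forall x y, 0 <= h x y) ->
  measurable_fun [set: R * R] (fun p => (h p.1 p.2)%:E) ->
  (\int[mu]_x (a%:E * \int[mu]_u (h x u)%:E) =
   a%:E * \int[mu]_u \int[mu]_x (h x u)%:E)%E.
Proof.
move=> a0 h0 mh.
have hE0 (p : R * R) : (0 <= (h p.1 p.2)%:E)%E by rewrite lee_fin.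
have mF := measurable_fun_fubini_tonelli_F (m2 := mu) _ mh hE0.
have F0 x : setT x -> (0 <= fubini_F mu (fun p => (h p.1 p.2)%:E) x)%E.
  by move=> _; apply: integral_ge0 => u _; rewrite lee_fin.
transitivity (a%:E * \int[mu]_x \int[mu]_u (h x u)%:E)%E.
  by apply: (ge0_integralZl mu measurableT mF F0); rewrite lee_fin.
apply: (congr1 (fun z => a%:E * z)%E).
exact: (fubini_tonelli (m1 := mu) (m2 := mu) _ mh hE0).
Qed.

(** The rotation splits into two affine substitutions in one variable: [y] becomes [u = c x + s y]
    for fixed [x], then, after exchanging the integrals, [x] becomes the other rotated coordinate
    [v] for fixed [u]. The Jacobian factors [1/|s|] and [|s|] cancel, and the product density is
    rotation invariant. *)
Lemma normal_prob_rotation (c s : R) (A B : set R) :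
  c ^+ 2 + s ^+ 2 = 1 -> s != 0 -> measurable A -> measurable B ->
  ((phi \x phi)
     [set p : R * R | A (c * p.1 + s * p.2)%R /\ B (c * p.2 - s * p.1)%R] =
   phi A * phi B)%E.
Proof.
move=> cs s0 mA mB.
pose S := [set p : R * R | A (c * p.1 + s * p.2) /\ B (c * p.2 - s * p.1)].
have mS : measurable S.
  have -> : S = (fun p : R * R => c * p.1 + s * p.2) @^-1` A `&`
      (fun p : R * R => (- s) * p.1 + c * p.2) @^-1` B.
    by apply/seteqP; split => -[x y] /=; rewrite /S/= mulNr [- _ + _]addrC.
  by apply: measurableI; rewrite -[X in measurable X]setTI;
    apply: measurable_linear2.
have pdf0 x : 0 <= pdf x := normal_pdf_ge0 0 1 x.
have mpdf : measurable_fun [set: R] pdf by exact: measurable_normal_pdf.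
have m1 (E : set R) (a b : R) : measurable E ->
    measurable_fun [set: R * R] (fun p => \1_E (a * p.1 + b * p.2) : R).
  move=> mE; apply: measurableT_comp; [exact: measurable_indic|].
  exact: measurable_linear2.
have mp (a b : R) :
    measurable_fun [set: R * R] (fun p => pdf (a * p.1 + b * p.2)).
  by apply: measurableT_comp => //; exact: measurable_linear2.
(* The integrand in the coordinates [(x, u)], where [y = (u - c x) / s] and [v = (c u - x) / s]. The
   coefficients 0 and 1 are kept so that each factor is an instance of [m1] or [mp]. *)
pose h (x u : R) : R := \1_A (0 * x + 1 * u) * \1_B (- s^-1 * x + c / s * u) *
  (pdf (1 * x + 0 * u) * pdf (- (c / s) * x + s^-1 * u)).
pose k (u v : R) : R := (\1_A u * pdf u) * (\1_B v * pdf v).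
have h0 x u : 0 <= h x u by rewrite !mulr_ge0.
have mh : measurable_fun [set: R * R] (fun p => (h p.1 p.2)%:E).
  apply/measurable_EFinP; apply: measurable_funM; apply: measurable_funM;
    by [exact: m1|exact: mp].
have mh1 x : measurable_fun [set: R] (fun u => (h x u)%:E).
  exact: (measurableT_comp mh
    (measurable_fun_pair (measurable_cst x) (@measurable_id _ _ _))).
have mk u : measurable_fun [set: R] (fun v => (k u v)%:E).
  apply/measurable_EFinP; apply: measurable_funM => //.
  exact: measurable_funM.
transitivity (\int[mu]_x \int[mu]_y (h x (s * y + c * x)%R)%:E)%E.
  rewrite /product_measure1 /= ge0_integral_normal_prob//=; last first.
    exact: measurable_fun_xsection.
  apply: eq_integral => x _.
  rewrite normal_probE; last exact: measurable_xsection.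
  rewrite -ge0_integralZr//=; last 3 first.
  - apply/measurable_EFinP; apply: measurable_funM => //.
    by apply: measurable_indic; exact: measurable_xsection.
  - by move=> y _; rewrite lee_fin mulr_ge0.
  - by rewrite lee_fin.
  apply: eq_integral => y _; rewrite -EFinM /h; congr (_%:E).
  rewrite mul0r mul1r add0r mul1r mul0r addr0.
  have -> : - s^-1 * x + c / s * (s * y + c * x) = c * y - s * x.
    have -> : - s^-1 * x + c / s * (s * y + c * x) =
        (c * s * y + (c ^+ 2 - 1) * x) / s by field.
    have -> : c ^+ 2 - 1 = - s ^+ 2 by rewrite -cs; ring.
    by field.
  have -> : - (c / s) * x + s^-1 * (s * y + c * x) = y by field.
  rewrite -[LHS]mulrA [pdf x * pdf y]mulrC; congr (_ * _).
  rewrite !indicE mem_xsection -natrM mulnb; congr ((_ : bool)%:R).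
  apply/idP/andP; rewrite !inE /S /=; first by case; rewrite (addrC (s * y)).
  by case; rewrite (addrC (s * y)).
transitivity (\int[mu]_x (`|s|^-1%:E * \int[mu]_u (h x u)%:E))%E.
  apply: eq_integral => x _.
  by rewrite (ge0_integral_affine _ s0 (mh1 x))// => u; rewrite lee_fin.
transitivity (`|s|^-1%:E * \int[mu]_u \int[mu]_x (h x u)%:E)%E.
  by apply: lebesgue_fubiniZ => //; rewrite invr_ge0.
(* Second substitution: [x = c u - s v] and [y = s u + c v] express the old pair through the new
   one. *)
transitivity (`|s|^-1%:E *
    \int[mu]_u (`|(- s^-1)%R|^-1%:E * \int[mu]_v (k u v)%:E))%E.
  congr *%E; apply: eq_integral => u _.
  rewrite -(@ge0_integral_affine (- s^-1) (c * u / s) (fun v => (k u v)%:E));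
    last 3 first.
  - by rewrite oppr_eq0 invr_eq0.
  - exact: mk.
  - by move=> v; rewrite lee_fin !mulr_ge0.
  apply: eq_integral => x _; congr (_%:E).
  rewrite /h /k mul0r mul1r add0r mul1r mul0r addr0.
  set v := - s^-1 * x + c * u / s.
  have -> : - s^-1 * x + c / s * u = v by rewrite /v; field.
  have -> : x = c * u - s * v by rewrite /v; field.
  have -> : - (c / s) * (c * u - s * v) + s^-1 * u = s * u + c * v.
    have -> : - (c / s) * (c * u - s * v) + s^-1 * u =
        c * v + (1 - c ^+ 2) * u / s by field.
    by rewrite -cs; field.
  by rewrite normal_pdf_rotation// mulrACA.
under eq_integral => u _ do rewrite ge0_integral_indic_pdf ?mulr_ge0// muleCA.
have [b b0 ->] : exists2 b : R, 0 <= b & phi B = b%:E.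
  exists (fine (phi B)); first exact: fine_ge0.
  by rewrite fineK// fin_num_measure.
transitivity (`|s|^-1%:E * \int[mu]_u
    ((`|(- s^-1)%R|^-1 * b)%R * (\1_A u * pdf u)%R)%:E)%E.
  by apply: (congr1 (fun z => `|s|^-1%:E * z)%E); apply: eq_integral => u _;
    rewrite -!EFinM; congr (_%:E); ring.
rewrite ge0_integral_indic_pdf ?mulr_ge0 ?invr_ge0// muleA -EFinM muleC.
by rewrite normrN normfV invrK mulrA mulVf ?mul1r// normr_eq0.
Qed.

End NormalRotation.

(** * Joint laws and plane rotations of normal vectors *)

Section Independence.
Context {d : measure_display} {T : measurableType d} {R : realType}.
Variable P : probability T R.

(** Both sides are finite measures in [S] that agree on rectangles, a pi-system generating the
    product sigma-algebra. The event [C] and the factor [r] allow the law to be restricted to an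
    event; [C = setT] and [r = 1] give the plain joint law. *)
Lemma joint_law d1 d2 (S1 : measurableType d1) (S2 : measurableType d2)
    (m1 : probability S1 R) (m2 : probability S2 R)
    (X : T -> S1) (Y : T -> S2) (C : set T) (r : R) :
  measurable_fun setT X -> measurable_fun setT Y -> measurable C -> 0 <= r ->
  (forall A B, measurable A -> measurable B ->
     P (C `&` (X @^-1` A `&` Y @^-1` B)) = (r%:E * (m1 A * m2 B))%E) ->
  forall S, measurable S ->
    P (C `&` (fun w => (X w, Y w)) @^-1` S) = (r%:E * (m1 \x m2) S)%E.
Proof.
move=> mX mY mC r0 XY S mS.
have mXY : measurable_fun setT (fun w => (X w, Y w)).
  exact: measurable_fun_pair.
rewrite setIC.
rewrite -[LHS]/(pushforward (mrestr P mC) (fun w => (X w, Y w)) S).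
rewrite -[RHS]/(mscale (NngNum r0) (m1 \x m2)%E S).
pose G : set (set (S1 * S2)) :=
  [set C | exists A, measurable A /\ exists B, measurable B /\ C = A `*` B].
apply: (measure_unique G (fun=> setT)) => //.
- rewrite measurable_prod_measurableType //; congr (<<s _ >>).
  rewrite predeqE => E; split => [[A mA [B mB <-]]|[A [mA [B [mB ->]]]]].
    by exists A; split => //; exists B.
  by exists A => //; exists B.
- move=> _ _ [X1 [mX1 [X2 [mX2 ->]]]] [Y1 [mY1 [Y2 [mY2 ->]]]].
  rewrite -setXI; exists (X1 `&` Y1); split; first exact: measurableI.
  by exists (X2 `&` Y2); split => //; exact: measurableI.
- move=> _; exists setT; split => //; exists setT; split => //.
  by rewrite setXTT.
- by rewrite bigcup_const.
- move=> _ [A [mA [B [mB ->]]]].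
  rewrite -[RHS]/(r%:E * (m1 \x m2) (A `*` B))%E.
  rewrite product_measure1E//= -XY//.
  by rewrite -[LHS]/(P (_ `&` C)) setIC.
- move=> _; rewrite -[ltLHS]/(P (_ `&` C)).
  by rewrite preimage_setT setTI (le_lt_trans (probability_le1 _ _))// ltry.
Qed.

Definition rv_of (f : T -> R) (mf : measurable_fun setT f) : {RV P >-> R} :=
  mfun_Sub (mem_set mf).

Local Notation phi := (@normal_prob R 0 1).

(** The product rule with the normal values filled in contains the marginal laws: take all sets but
    one equal to [setT]. *)
Lemma std_normalP k (w : 'I_k -> {RV P >-> R}) :
  std_normal_vector w <->
  forall B : 'I_k -> set R, (forall i, measurable (B i)) ->
    P (\bigcap_(i in setT) (w i @^-1` B i)) = (\prod_(i < k) phi (B i))%E.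
Proof.
split=> [[w1 w2] B mB|H].
  by rewrite w2//; apply: eq_bigr => i _; rewrite w1.
have H1 i (B : set R) : measurable B -> P (w i @^-1` B) = phi B.
  move=> mB; have := H (fun j => if j == i then B else setT).
  rewrite (bigD1 i)//= eqxx big1 ?mule1; last first.
    by move=> j /negbTE ->; rewrite probability_setT.
  move=> <-; last by move=> j; case: ifP.
  congr (P _); apply/seteqP; split => [x Bx j _|x /(_ i I)]; last first.
    by rewrite eqxx.
  by have [->|] := eqVneq j i.
by split=> // B mB; rewrite H//; apply: eq_bigr => i _; rewrite H1.
Qed.

(** Restricted to an event on the other coordinates, the pair [(w i, w j)] still has a multiple of
    the product normal law, by [joint_law], and [normal_prob_rotation] applies to it. *)
Lemma std_normal_rotation k (w : 'I_k -> {RV P >-> R}) (i j : 'I_k) (c s : R) :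
  i != j -> c ^+ 2 + s ^+ 2 = 1 -> s != 0 -> std_normal_vector w ->
  exists w' : 'I_k -> {RV P >-> R}, [/\ std_normal_vector w',
    forall om, w' i om = c * w i om + s * w j om,
    forall om, w' j om = c * w j om - s * w i om &
    forall p, p != i -> p != j -> w' p = w p].
Proof.
move=> ij cs s0 /std_normalP stdw.
have mu : measurable_fun setT (fun om => c * w i om + s * w j om).
  by apply: measurable_funD; apply: measurable_funM.
have mv : measurable_fun setT (fun om => c * w j om - s * w i om).
  by apply: measurable_funB; apply: measurable_funM.
pose w' p := if p == i then rv_of mu else if p == j then rv_of mv else w p.
have ji : (j == i) = false by rewrite eq_sym; exact: negbTE.
have w'i : w' i = rv_of mu by rewrite /w' eqxx.
have w'j : w' j = rv_of mv by rewrite /w' ji eqxx.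
have w'p p : p != i -> p != j -> w' p = w p.
  by rewrite /w' => /negbTE -> /negbTE ->.
exists w'; split => //; last 2 first.
- by move=> om; rewrite w'i.
- by move=> om; rewrite w'j.
apply/std_normalP => B mB.
pose C := \bigcap_(p in [set p | p != i /\ p != j]) (w p @^-1` B p).
have mC : measurable C.
  apply: fin_bigcap_measurable; [exact: finite_finset|move=> p _].
  exact: measurable_funPTI.
(* [r] is the probability of [C], the event on the coordinates other than [i] and [j]. *)
pose r := fine (\prod_(p < k | (p != i) && (p != j)) phi (B p))%E.
have rE : (\prod_(p < k | (p != i) && (p != j)) phi (B p))%E = r%:E.
  rewrite fineK//; elim/big_ind : _ => // [x y|p _].
    exact: fin_numM.
  exact: (fin_num_measure (normal_prob 0 1)) (mB p).
have r0 : 0 <= r.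
  rewrite fine_ge0//; elim/big_ind : _ => // x y; exact: mule_ge0.
have mw p : measurable_fun setT (w p) by exact: measurable_funPT.
have law := @joint_law _ _ _ _ phi phi (w i) (w j) C r (mw i) (mw j) mC r0 _.
have prodE (D : 'I_k -> set R) : (forall p, p != i -> p != j -> D p = B p) ->
    (\prod_(p < k) phi (D p) = r%:E * (phi (D i) * phi (D j)))%E.
  move=> DB; rewrite (bigD1 i)//= (bigD1 j)/=; last by rewrite eq_sym.
  rewrite (eq_bigr (fun p => phi (B p))) ?rE; first by rewrite muleA muleC.
  by move=> p /andP[pi pj]; rewrite DB.
rewrite prodE// -(normal_prob_rotation cs s0 (mB i) (mB j)).
rewrite -law//; last 2 first.
- move=> A1 A2 mA1 mA2.
  (* Replacing the sets at [i] and [j] by [A1] and [A2] turns the product rule for [w] into the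
     value on a rectangle. *)
  pose D p := if p == i then A1 else if p == j then A2 else B p.
  have Di : D i = A1 by rewrite /D eqxx.
  have Dj : D j = A2 by rewrite /D ji eqxx.
  have Dp p : p != i -> p != j -> D p = B p.
    by rewrite /D => /negbTE -> /negbTE ->.
  have := prodE D Dp; rewrite Di Dj => <-; rewrite -stdw; last first.
    by move=> p; rewrite /D; case: ifP => // _; case: ifP.
  congr (P _); apply/seteqP; split => [om [Com [Aom1 Aom2]] p _|om Dom].
    have [->|pi] := eqVneq p i; first by rewrite Di.
    have [->|pj] := eqVneq p j; first by rewrite Dj.
    by rewrite Dp//; apply: Com.
  split; first by move=> p [pi pj]; rewrite -Dp//; exact: Dom.
  by split; [rewrite -Di|rewrite -Dj]; exact: Dom.
- rewrite (_ : [set p | _] = (fun p : R * R => c * p.1 + s * p.2) @^-1` B i `&`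
      (fun p : R * R => (- s) * p.1 + c * p.2) @^-1` B j); last first.
    by apply/seteqP; split => -[u v] /=; rewrite mulNr [- _ + _]addrC.
  by apply: measurableI; rewrite -[X in measurable X]setTI;
    apply: measurable_linear2.
congr (P _); apply/seteqP; split => [om Bom|om [Com [Bi Bj]] p _].
  split; first by move=> p [pi pj]; rewrite -w'p//; exact: Bom.
  split => /=.
    by have := Bom i I; rewrite w'i.
  by have := Bom j I; rewrite w'j.
have [->|pi] := eqVneq p i; first by rewrite w'i.
have [->|pj] := eqVneq p j; first by rewrite w'j.
by rewrite w'p//; apply: Com.
Qed.

End Independence.

(** * LQ decomposition by plane rotations *)

Section LQ.
Context {d : measure_display} {T : measurableType d} {R : realType}.
Variable P : probability T R.

Definition plane_rotation k (i j : 'I_k) (c s : R) (u : 'I_k -> R) :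
    'I_k -> R :=
  fun p => if p == i then c * u i + s * u j
           else if p == j then c * u j - s * u i else u p.

(** With [v] the noise vector this preserves the affine image; with [v] another row of the matrix it
    preserves the Gram matrix. *)
Lemma sum_plane_rotation k (i j : 'I_k) (c s : R) (u v : 'I_k -> R) :
  i != j -> c ^+ 2 + s ^+ 2 = 1 ->
  \sum_p plane_rotation i j c s u p * plane_rotation i j c s v p =
  \sum_p u p * v p.
Proof.
move=> ij cs; have ji : j != i by rewrite eq_sym.
rewrite (bigD1 i)//= (bigD1 j)//= [RHS](bigD1 i)//= (bigD1 j ji)//= !addrA.
congr (_ + _); last first.
  apply: eq_bigr => p /andP[pi pj].
  by rewrite /plane_rotation (negbTE pi) (negbTE pj).
rewrite /plane_rotation !eqxx (negbTE ji).
transitivity ((c ^+ 2 + s ^+ 2) * (u i * v i + u j * v j)); first by ring.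
by rewrite cs mul1r.
Qed.

(** Stands for [L = B Q] and [w' = Q^T w] with [Q] orthogonal, recorded only through the invariants
    used later. *)
Definition orthogonal_change k r (B : 'M[R]_(k, r)) (w : 'I_r -> {RV P >-> R})
    (L : 'M[R]_(k, r)) (w' : 'I_r -> {RV P >-> R}) : Prop :=
  [/\ std_normal_vector w',
      forall p om, \sum_i L p i * w' i om = \sum_i B p i * w i om &
      L *m L^T = B *m B^T].

Lemma orthogonal_change_trans k r (B1 B2 B3 : 'M[R]_(k, r)) w1 w2 w3 :
  orthogonal_change B1 w1 B2 w2 -> orthogonal_change B2 w2 B3 w3 ->
  orthogonal_change B1 w1 B3 w3.
Proof.
move=> [w2n e12 g12] [w3n e23 g23]; split=> //; last by rewrite g23.
by move=> p om; rewrite e23 e12.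
Qed.

(** The rotation sends [(B n i, B n j)] to [(rho, 0)]. The last two clauses ensure that zeros
    created earlier survive. *)
Lemma givens k r (B : 'M[R]_(k, r)) (w : 'I_r -> {RV P >-> R}) (n : 'I_k)
    (i j : 'I_r) :
  std_normal_vector w -> i != j ->
  exists L w', [/\ orthogonal_change B w L w', L n j = 0,
    forall p, B p i = 0 -> B p j = 0 -> L p i = 0 /\ L p j = 0 &
    forall p q, q != i -> q != j -> L p q = B p q].
Proof.
move=> stdw ij; have ji : j != i by rewrite eq_sym.
(* An entry that is already zero calls for no rotation; otherwise the sine is nonzero, as
   [std_normal_rotation] requires. *)
have [Bnj|Bnj] := eqVneq (B n j) 0; first by exists B, w.
pose rho := Num.sqrt (B n i ^+ 2 + B n j ^+ 2).
have rho2 : rho ^+ 2 = B n i ^+ 2 + B n j ^+ 2.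
  by rewrite sqr_sqrtr// addr_ge0// sqr_ge0.
have rho0 : rho != 0.
  rewrite -sqrf_eq0 rho2 gt_eqF// ltr_wpDl ?sqr_ge0//.
  by rewrite exprn_even_gt0.
have cs : (B n i / rho) ^+ 2 + (B n j / rho) ^+ 2 = 1.
  by rewrite !expr_div_n -mulrDl -rho2 divff// sqrf_eq0.
have s0 : B n j / rho != 0 by rewrite mulf_neq0// invr_eq0.
have [w' [stdw' w'i w'j w'p]] := std_normal_rotation ij cs s0 stdw.
move: cs w'i w'j {s0}; set c := B n i / rho; set s := B n j / rho => cs w'i w'j.
exists (\matrix_(p, q) plane_rotation i j c s (B p) q), w'; split.
- split=> // [p om|].
    rewrite -(sum_plane_rotation (B p) (fun q => w q om) ij cs).
    apply: eq_bigr => q _; rewrite mxE; congr (_ * _).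
    rewrite /plane_rotation; have [->|qi] := eqVneq q i; first exact: w'i.
    have [->|qj] := eqVneq q j; first exact: w'j.
    by rewrite w'p.
  apply/matrixP => p q; rewrite !mxE.
  under eq_bigr do rewrite !mxE.
  under [RHS]eq_bigr do rewrite mxE.
  exact: sum_plane_rotation.
- rewrite mxE /plane_rotation eqxx (negbTE ji) /c /s.
  by field.
- move=> p Bi Bj; rewrite !mxE /plane_rotation !eqxx (negbTE ji) Bi Bj.
  by rewrite !mulr0 addr0 subrr.
- by move=> p q qi qj; rewrite mxE /plane_rotation (negbTE qi) (negbTE qj).
Qed.

(** Givens elimination: the rows are treated in order, and in row [n] the entries right of the
    diagonal are cleared one by one against column [n]. *)
Lemma std_normal_LQ k r (B : 'M[R]_(k, r)) (w : 'I_r -> {RV P >-> R}) :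
  std_normal_vector w ->
  exists L w', orthogonal_change B w L w' /\
    forall (p : 'I_k) (q : 'I_r), (p < q)%N -> L p q = 0.
Proof.
move=> stdw.
suff H n : exists L w', orthogonal_change B w L w' /\
    forall (p : 'I_k) (q : 'I_r), (p < n)%N -> (p < q)%N -> L p q = 0.
  have [L [w' [BL L0]]] := H k; exists L, w'; split => // p q.
  exact: L0.
elim: n => [|n [L [w' [BL L0]]]]; first by exists B, w.
have [nk|kn] := ltnP n k; last first.
  exists L, w'; split => // p q _; apply: L0.
  exact: leq_trans (ltn_ord p) kn.
(* For [n >= r], row [n] has no entry right of the diagonal. *)
have [nr|rn] := ltnP n r; last first.
  exists L, w'; split => // p q.
  rewrite ltnS leq_eqVlt => /orP[/eqP ->|]; last exact: L0.
  move=> nq; have := leq_trans (leq_trans nq (ltnW (ltn_ord q))) rn.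
  by rewrite ltnn.
(* Inner induction: the rows before [n] are done, and row [n] is cleared up to column [n + t]. *)
suff H t : exists L w', orthogonal_change B w L w' /\
   forall (p : 'I_k) (q : 'I_r), (p < q)%N ->
     (p < n)%N \/ ((p : nat) = n /\ (q <= n + t)%N) -> L p q = 0.
  have [L1 [w1 [BL1 L10]]] := H r; exists L1, w1; split => // p q.
  rewrite ltnS leq_eqVlt => /orP[/eqP pn|pn] pq; apply: L10 => //; last by left.
  by right; split => //; rewrite (leq_trans (ltnW (ltn_ord q)))// leq_addl.
elim: t => [|t [L1 [w1 [BL1 L10]]]].
  exists L, w'; split => // p q pq [pn|[pn]]; first exact: L0.
  by rewrite addn0 -pn leqNgt pq.
have [ntr|rnt] := ltnP (n + t.+1) r; last first.
  exists L1, w1; split => // p q pq [pn|[pn _]]; apply: L10 => //.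
    by left.
  right; split => //; rewrite -ltnS -addnS.
  exact: leq_trans (ltn_ord q) rnt.
pose i := Ordinal nr; pose j := Ordinal ntr.
have ij : i != j by rewrite -val_eqE /= -[X in X == _]addn0 eqn_add2l.
have [w1n _ _] := BL1.
have [L2 [w2 [L12 L2n L2z L2q]]] := givens L1 (Ordinal nk) w1n ij.
exists L2, w2; split; first exact: orthogonal_change_trans BL1 L12.
move=> p q pq [pn|[pn qnt]].
  (* Rows above [n] vanish in both rotated columns, so they keep their zeros. *)
  have [L2i L2j] : L2 p i = 0 /\ L2 p j = 0.
    apply: L2z; apply: L10 => //=; try by left.
    by rewrite (leq_trans pn)// leq_addr.
  have [->//|qi] := eqVneq q i; have [->//|qj] := eqVneq q j.
  by rewrite L2q//; apply: L10 => //; left.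
have [->|qj] := eqVneq q j.
  by rewrite -L2n; congr (L2 _ _); exact: val_inj.
rewrite L2q//; last first.
  by rewrite -val_eqE /= -pn gtn_eqF.
apply: L10 => //; right; split => //.
move: qnt; rewrite leq_eqVlt => /orP[/eqP qE|]; last by rewrite addnS ltnS.
by move: qj; rewrite -val_eqE /= qE eqxx.
Qed.

End LQ.

(** * Versions of conditional probabilities *)

Section ConditionalProbability.
Context {d : measure_display} {T : measurableType d} {R : realType}.
Variables (P : probability T R) (gen : set (set T)).
Hypothesis gen_measurable : gen `<=` measurable.

Local Notation TG := (g_sigma_algebraType gen).

Lemma g_sigma_measurable (C : set T) : <<s gen >> C -> measurable C.
Proof.
move=> GC.
exact: (smallest_sub (@sigma_algebra_measurable _ T) gen_measurable).
Qed.

Lemma measurable_id_g_sigma : measurable_fun [set: T] (fun w => w : TG).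
Proof. by move=> _ C GC; rewrite setTI; exact: g_sigma_measurable. Qed.

(** The restriction of [P] to the generated sigma-algebra, obtained as the law of the identity map
    into [TG]. *)
Let PG : probability TG R :=
  distribution P (mfun_Sub (mem_set measurable_id_g_sigma)).

(** Since [V] has law [nu] and is independent of the sigma-algebra, the pair [(w, V w)] has law
    [PG \x nu]. Fubini on the part of [S] above [C] then shows that freezing [w] and integrating out
    [V] is a version. *)
Lemma cond_prob_kernel d2 (S2 : measurableType d2) (nu : probability S2 R)
    (V : T -> S2) (S : set (TG * S2)) :
  measurable_fun setT V ->
  (forall C B, <<s gen >> C -> measurable B ->
     P (C `&` V @^-1` B) = (P C * nu B)%E) ->
  measurable S ->
  is_cond_prob P <<s gen >> [set w | S (w, V w)]
    (fun w => fine (nu (xsection S w))).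
Proof.
move=> mV indep mS.
have law (S' : set (TG * S2)) : measurable S' ->
    P [set w | S' (w, V w)] = (\int[P]_w nu (xsection S' w))%E.
  move=> mS'.
  transitivity ((PG \x nu)%E S').
    have := @joint_law _ _ _ P _ _ TG S2 PG nu (fun w => w) V setT 1
      measurable_id_g_sigma mV measurableT ler01.
    move=> /(_ _ S' mS'); rewrite setTI mul1e; apply => A B mA mB.
    by rewrite setTI mul1e indep.
  rewrite /product_measure1 ge0_integral_pushforward//.
  exact: measurable_fun_xsection.
have mq : measurable_fun [set: TG] (fun w => nu (xsection S w)).
  exact: measurable_fun_xsection.
have mp : measurable_fun [set: TG] (fun w => fine (nu (xsection S w))).
  by apply: measurableT_comp mq; exact: fine_measurable.
have mpT : measurable_fun [set: T] (fun w => fine (nu (xsection S w))).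
  exact: (measurableT_comp mp measurable_id_g_sigma).
have nuE w : (fine (nu (xsection S w)))%:E = nu (xsection S w).
  by rewrite fineK// fin_num_measure//; exact: measurable_xsection.
split.
- by move=> B mB; rewrite -[_ @^-1` _]setTI; exact: mp.
- apply: (le_integrable measurableT (g := EFin \o cst 1)).
  + exact/measurable_EFinP.
  + move=> w _ /=; rewrite normr1 ger0_norm ?fine_ge0// nuE.
    by apply: probability_le1; exact: measurable_xsection.
  + exact: finite_measure_integrable_cst.
- move=> C GC.
  have mSC : measurable (S `&` (C `*` [set: S2]) : set (TG * S2)).
    by apply: measurableI => //; exact: measurableX.
  have -> : [set w | S (w, V w)] `&` C =
      [set w | (S `&` (C `*` [set: S2])) (w, V w)].
    by apply/seteqP; split => [w [Sw Cw]|w [Sw [Cw _]]]; split.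
  rewrite law// integral_mkcond; apply: eq_integral => w _.
  rewrite xsectionI patchE; case: ifPn => wC.
    by rewrite in_xsectionX// setIT.
  by rewrite notin_xsectionX// setI0 measure0.
Qed.

(** Both versions are measurable on [TG] with equal integrals over every set of the sigma-algebra,
    hence agree [PG]-almost everywhere, and a [PG]-null set is [P]-null. *)
Lemma cond_prob_unique (E : set T) (p q : T -> R) :
  is_cond_prob P <<s gen >> E p -> is_cond_prob P <<s gen >> E q ->
  {ae P, forall w, p w = q w}.
Proof.
move=> [Gp ip pE] [Gq iq qE].
have mp : measurable_fun [set: TG] (EFin \o p).
  by apply/measurable_EFinP => _ B mB; rewrite setTI; exact: Gp.
have mq : measurable_fun [set: TG] (EFin \o q).
  by apply/measurable_EFinP => _ B mB; rewrite setTI; exact: Gq.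
have : ae_eq PG setT (EFin \o p) (EFin \o q).
  apply: integral_ae_eq => //.
  - exact: integrable_pushforward.
  - move=> C _ GC; have mC := g_sigma_measurable GC.
    rewrite !integral_pushforward//; last 2 first.
    + exact: integrableS iq.
    + exact: integrableS ip.
    by rewrite pE// qE.
move=> [N [mN PN0 NE]]; exists N; split => //; first exact: g_sigma_measurable.
by move=> w /= pq; apply: NE => /= /(_ I) [].
Qed.

End ConditionalProbability.

(** * A strict association inequality for normal variables *)

Lemma product_probability_fin_num d1 d2 (T1 : measurableType d1)
    (T2 : measurableType d2) (R : realType) (P1 : probability T1 R)
    (P2 : probability T2 R) (A : set (T1 * T2)) :
  measurable A -> (P1 \x P2)%E A \is a fin_num.
Proof.
by move=> mA; apply: (fin_num_measure ((P1 \x P2)%E : probability _ R)).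
Qed.

(* Chebyshev's association inequality; [K] separates the sections of [S] over
   [I] from those over its complement, and [I1 `*` K1] makes it strict. *)
Lemma product_association d1 d2 (T1 : measurableType d1)
    (T2 : measurableType d2) (R : realType) (P1 : probability T1 R)
    (P2 : probability T2 R) (I I1 : set T1) (K K1 : set T2)
    (S : set (T1 * T2)) :
  measurable I -> measurable I1 -> measurable K -> measurable K1 ->
  measurable S -> I1 `<=` I -> K `&` K1 = set0 ->
  I `*` K `<=` S -> I1 `*` K1 `<=` S -> S `&` (~` I `*` setT) `<=` ~` I `*` K ->
  (0 < P1 I)%E -> (0 < P1 (~` I))%E -> (0 < P1 I1)%E -> (0 < P2 K1)%E ->
  (P1 I * (P1 \x P2) S < (P1 \x P2) (S `&` (I `*` setT)))%E.
Proof.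
move=> mI mI1 mK mK1 mS I1I KK1 IKS I1K1S SK.
have mJ : measurable (~` I) by exact: measurableC.
have mSX A : measurable A -> measurable (S `&` (A `*` setT)).
  by move=> mA; apply: measurableI => //; exact: measurableX.
have lower : (P1 I * P2 K + P1 I1 * P2 K1 <=
    (P1 \x P2) (S `&` (I `*` setT)))%E.
  rewrite -!product_measure1E// -measureU//; last 3 first.
  - exact: measurableX.
  - exact: measurableX.
  - apply/seteqP; split => // e [[_ Ke] [_ K1e]].
    by rewrite -[set0 e]/(set0 e.2) -KK1.
  apply: le_measure; rewrite ?inE.
  - by apply: measurableU; exact: measurableX.
  - exact: mSX.
  - move=> e [IKe|I1K1e]; first by split; [exact: IKS|case: IKe].
    by split; [exact: I1K1S|split => //; apply: I1I; case: I1K1e].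
have upper : ((P1 \x P2) (S `&` (~` I `*` setT)) <= P1 (~` I) * P2 K)%E.
  rewrite -product_measure1E//; apply: le_measure; rewrite ?inE//.
  - exact: mSX.
  - exact: measurableX.
have -> : (P1 \x P2)%E S = ((P1 \x P2) (S `&` (I `*` setT)) +
    (P1 \x P2) (S `&` (~` I `*` setT)))%E.
  rewrite -measureU//; last 3 first.
  - exact: mSX.
  - exact: mSX.
  - by apply/seteqP; split => // e [[_ [Ie _]] [_ [Je _]]].
  congr ((P1 \x P2)%E _); apply/seteqP; split => [e Se|e [[]|[]]//].
  by have [Ie|Je] := pselect (I e.1); [left|right].
move: lower upper; rewrite probability_setC//.
have fin1 A : measurable A -> P1 A = (fine (P1 A))%:E.
  by move=> mA; rewrite fineK// fin_num_measure.
have fin2 A : measurable A -> P2 A = (fine (P2 A))%:E.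
  by move=> mA; rewrite fineK// fin_num_measure.
have fin12 A : measurable A -> (P1 \x P2)%E A = (fine ((P1 \x P2)%E A))%:E.
  by move=> mA; rewrite fineK//; exact: product_probability_fin_num.
rewrite (fin1 I)// (fin1 I1)// (fin2 K)// (fin2 K1)// (fin12 _ (mSX I mI))
  (fin12 _ (mSX _ mJ)).
set p := fine (P1 I); set i1 := fine (P1 I1); set k := fine (P2 K).
set k1 := fine (P2 K1); set al := fine _; set be := fine _.
rewrite -!EFinB -!EFinM -!EFinD -?EFinM !lee_fin !lte_fin.
move=> Hal Hbe p0 q0 i10 k10.
(* The goal is [p * (al + be) < al], that is [p * be < (1 - p) * al]. It follows from
   [be <= (1 - p) * k] and [p * k < al], the latter strict because [i1 * k1 > 0]. *)
have : 0 < (1 - p) * (al - p * k).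
  by rewrite mulr_gt0// subr_gt0 (lt_le_trans _ Hal)// ltrDl mulr_gt0.
have : 0 <= p * ((1 - p) * k - be) by rewrite mulr_ge0 ?(ltW p0)// subr_ge0.
lra.
Qed.

Section Association.
Context {R : realType}.
Local Notation phi := (@normal_prob R 0 1).
Local Notation mu := (@lebesgue_measure R).
Local Notation phi2 := (phi \x phi)%E.

Lemma measurable_set_gt0 d (T : measurableType d) (f : T -> R) :
  measurable_fun [set: T] f -> measurable [set x | 0 < f x].
Proof.
move=> mf; have -> : [set x | 0 < f x] = f @^-1` `]0, +oo[.
  by apply/seteqP; split => x /=; rewrite in_itv/= andbT.
by rewrite -[X in measurable X]setTI; apply: mf => //; exact: measurable_itv.
Qed.

(** The density is positive everywhere, so it cannot vanish almost everywhere on an interval of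
    positive length. *)
Lemma normal_prob_gt0 (A : set R) (l r : R) :
  measurable A -> l < r -> `]l, r[ `<=` A -> (0 < phi A)%E.
Proof.
move=> mA lr sA.
suff : (0 < phi `]l, r[%classic)%E.
  by move=> /lt_le_trans; apply; apply: le_measure; rewrite ?inE.
rewrite lt_neqAle measure_ge0 andbT eq_sym; apply/eqP => phi0.
have mpdf : measurable_fun (`]l, r[%classic : set R)
    (EFin \o normal_pdf (0 : R) 1).
  by apply/measurable_EFinP/measurable_funTS; exact: measurable_normal_pdf.
have : ae_eq mu `]l, r[%classic (EFin \o normal_pdf (0 : R) 1) (cst 0%E).
  apply: (ae_eq_integral_abs mu (measurable_itv `]l, r[) mpdf).1.
  rewrite -[RHS]phi0; apply: eq_integral => x _ /=.
  by rewrite ger0_norm// normal_pdf_ge0.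
move=> [N [mN N0 NE]].
have : (mu `]l, r[%classic <= mu N)%E.
  apply: le_measure; rewrite ?inE// => x lrx; apply: NE => /=.
  move=> /(_ lrx) /eqP; rewrite eqe normal_pdf01E gt_eqF//.
  by rewrite mulr_gt0 ?expR_gt0// normal_peak_gt0// oner_eq0.
by rewrite N0 lebesgue_measure_itv/= lte_fin lr leNgt lte_fin subr_gt0 lr.
Qed.

(** As [b > 0], the sections of the second event increase with the first coordinate, so
    [product_association] applies; as [g != 0], they increase strictly. *)
Lemma normal_association (u v a b g : R) : 0 < a -> 0 < b -> g != 0 ->
  (phi [set x | (0 < u + a * x)%R] *
   phi2 [set e | (0 < v + b * e.1 + g * e.2)%R] <
   phi2 [set e | (0 < u + a * e.1)%R /\ (0 < v + b * e.1 + g * e.2)%R])%E.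
Proof.
move=> a0 b0 g0.
have mhalf (c1 c2 : R) : measurable [set y : R | 0 < c1 + c2 * y].
  apply: measurable_set_gt0.
  by apply: measurable_funD => //; apply: measurable_funM.
have mhalf2 : measurable [set e : R * R | 0 < v + b * e.1 + g * e.2].
  apply: measurable_set_gt0.
  apply: measurable_funD; [apply: measurable_funD => //|];
    exact: measurable_funM.
(* [I] is the half-line above [x0] and [K] the section of [S] at [x0]. [I1] is the half-line above
   [x0 + 1], and [K1] is what the section gains between [x0] and [x0 + 1]. *)
pose x0 := - u / a.
pose I := [set x | 0 < u + a * x]; pose J := ~` I.
pose K := [set y | 0 < v + b * x0 + g * y].
pose I1 := [set x | 0 < (u - a) + a * x].
pose K1 := [set y | 0 < v + b * (x0 + 1) + g * y] `\` K.
pose S := [set e : R * R | 0 < v + b * e.1 + g * e.2].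
have mI : measurable I by exact: mhalf.
have mJ : measurable J by exact: measurableC.
have mK : measurable K by exact: mhalf.
have mI1 : measurable I1 by exact: mhalf.
have mK1 : measurable K1 by apply: measurableD; exact: mhalf.
have mS : measurable S by [].
have IE x : I x = (x0 < x) :> Prop.
  congr is_true; rewrite ltr_pdivrMr// -[RHS]subr_gt0.
  by congr (_ < _); ring.
have I1E x : I1 x = (x0 + 1 < x) :> Prop.
  congr is_true; rewrite -ltrBrDr ltr_pdivrMr// -[RHS]subr_gt0.
  by congr (_ < _); ring.
have phiI : (0 < phi I)%E.
  apply: (@normal_prob_gt0 _ x0 (x0 + 1)) => //; first by rewrite ltrDl.
  by move=> x /=; rewrite IE in_itv/= => /andP[].
have phiJ : (0 < phi J)%E.
  apply: (@normal_prob_gt0 _ (x0 - 1) x0) => //; first by rewrite ltrBlDr ltrDl.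
  move=> x /=; rewrite in_itv/= => /andP[_ xx0]; rewrite /J/= IE.
  by apply/negP; rewrite -leNgt ltW.
have phiI1 : (0 < phi I1)%E.
  apply: (@normal_prob_gt0 _ (x0 + 1) (x0 + 1 + 1)) => //.
    by rewrite ltrDl.
  by move=> x /=; rewrite I1E in_itv/= => /andP[].
have phiK1 : (0 < phi K1)%E.
  (* The endpoints of the sections at [x0] and [x0 + 1]. [K1] is the interval between them, and the
     sign of [g] decides their order. *)
  pose y0 := - (v + b * x0) / g; pose y1 := - (v + b * (x0 + 1)) / g.
  have yE : y1 = y0 - b / g by rewrite /y1 /y0; field.
  have K1E y : K1 y = (if 0 < g then y1 < y <= y0 else y0 <= y < y1) :> Prop.
    rewrite /K1 /K /setD /= propeqE.
    have -> : v + b * (x0 + 1) + g * y = g * (y - y1) by rewrite /y1; field.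
    have -> : v + b * x0 + g * y = g * (y - y0) by rewrite /y0; field.
    case: ifPn => [gp|]; rewrite -?leNgt.
      rewrite !pmulr_rgt0// !subr_gt0.
      split=> [[-> /negP]|/andP[-> yy0]]; first by rewrite -leNgt.
      by split => //; apply/negP; rewrite -leNgt.
    rewrite le_eqVlt (negbTE g0)/= => gn.
    rewrite !nmulr_rgt0// !subr_lt0.
    split=> [[-> /negP]|/andP[y0y ->]]; first by rewrite -leNgt => ->.
    by split => //; apply/negP; rewrite -leNgt.
  have [gp|gn] := ltP 0 g.
    apply: (@normal_prob_gt0 _ y1 y0) => //.
      by rewrite yE ltrBlDr ltrDl divr_gt0.
    by move=> y /=; rewrite in_itv/= K1E gp => /andP[-> /ltW].
  have {}gn : g < 0 by rewrite lt_neqAle g0.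
  have ng : (0 < g) = false by rewrite ltNge (ltW gn).
  apply: (@normal_prob_gt0 _ y0 y1) => //.
    by rewrite yE ltrBrDr gtrDl pmulr_rlt0 ?invr_lt0.
  by move=> y /=; rewrite in_itv/= K1E ng => /andP[/ltW -> ->].
have -> : [set e | 0 < u + a * e.1 /\ 0 < v + b * e.1 + g * e.2] =
    S `&` (I `*` setT).
  by apply/seteqP; split => e /=; [case|case=> ? []].
apply: (product_association (P1 := normal_prob 0 1) (P2 := normal_prob 0 1)
  (I := I) (I1 := I1) (K := K) (K1 := K1) (S := S)) => //.
- by move=> x; rewrite IE I1E; apply: lt_trans; rewrite ltrDl.
- by apply/seteqP; split => // y [Ky [_]].
- move=> [x y] [/= Ix Ky]; move: Ix Ky; rewrite IE /K /S /= => Ix /lt_trans.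
  by apply; rewrite ltrD2r ltrD2l ltr_pM2l.
- move=> [x y] [/= I1x [K1y _]].
  move: I1x K1y; rewrite I1E /S /= => I1x /lt_trans.
  by apply; rewrite ltrD2r ltrD2l ltr_pM2l.
- move=> [x y] [Sxy [/= Jx _]]; split => //=.
  move: Jx Sxy; rewrite IE => /negP; rewrite -leNgt => xx0.
  by rewrite /S /K /= => /lt_le_trans; apply; rewrite lerD2r lerD2l ler_pM2l.
Qed.

End Association.

(** * Conditional independence read off from residuals *)

Section CondIndep.
Context {d : measure_display} {T : measurableType d} {R : realType}.
Variable P : probability T R.
Local Notation phi := (@normal_prob R 0 1).
Local Notation phi2 := (phi \x phi)%E.

Section Generator.
Context {I : Type} (X : I -> {RV P >-> R}).

(** The generating family inside [sigma_of], named so that measurability with respect to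
    [sigma_of X D] can be expressed through [g_sigma_algebraType]. *)
Definition generator (D : set I) : set (set T) :=
  \bigcup_(k in D) preimage_set_system setT (X k) measurable.

Lemma generator_measurable D : generator D `<=` measurable.
Proof.
by move=> _ [k _ [B mB <-]]; rewrite setTI; exact: measurable_funPTI.
Qed.

(** The preimages of measurable sets under one variable already form a sigma-algebra. *)
Lemma sigma_of_set1 (a : I) (E : set T) :
  sigma_of X [set a] E <-> exists2 A, measurable A & E = X a @^-1` A.
Proof.
rewrite /sigma_of bigcup_set1; split=> [|[A mA ->]]; last first.
  by apply: sub_sigma_algebra; exists A => //; rewrite setTI.
move: E; apply: smallest_sub.
  split.
  - by exists set0; rewrite ?preimage_set0.
  - by move=> _ [A mA ->]; exists (~` A); [exact: measurableC|rewrite setTD].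
  - move=> F /= FX; pose G n := sval (cid2 (FX n)).
    exists (\bigcup_n G n).
      by apply: bigcup_measurable => n _; rewrite /G; case: cid2.
    rewrite preimage_bigcup; apply: eq_bigcupr => n _.
    by rewrite /G; case: cid2.
by move=> _ [A mA <-]; exists A => //; rewrite setTI.
Qed.

End Generator.

(** [V1] and [V2] are independent standard normals, jointly independent of the variables in [D].
    Integrating them out gives explicit versions, which factor if [c = 0] and are strictly
    associated for suitable half-lines if [c != 0]. *)
Lemma cond_indep_residuals (I : Type) (X : I -> {RV P >-> R}) (D : set I)
    (a b : I) (Za Zb V1 V2 : T -> R) (s c t : R) :
  measurable_fun [set: g_sigma_algebraType (generator X D)] Za ->
  measurable_fun [set: g_sigma_algebraType (generator X D)] Zb ->
  measurable_fun [set: T] V1 -> measurable_fun [set: T] V2 ->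
  (forall C A B, sigma_of X D C -> measurable A -> measurable B ->
     P (C `&` (V1 @^-1` A `&` V2 @^-1` B)) = (P C * (phi A * phi B))%E) ->
  (forall w, X a w = Za w + s * V1 w) ->
  (forall w, X b w = Zb w + c * V1 w + t * V2 w) ->
  s != 0 -> t != 0 ->
  cond_indep X [set a] [set b] D <-> c = 0.
Proof.
move=> mZa mZb mV1 mV2 indep XaE XbE s0 t0.
have phiT : phi [set: R] = 1%E by exact: (probability_setT (normal_prob 0 1)).
have phi2X A B : measurable A -> measurable B ->
    phi2 (A `*` B) = (phi A * phi B)%E.
  by move=> mA mB; exact: product_measure1E.
have phi2XT A : measurable A -> phi2 (A `*` setT) = phi A.
  by move=> mA; rewrite phi2X// phiT mule1.
have phi2TX A : measurable A -> phi2 (setT `*` A) = phi A.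
  by move=> mA; rewrite phi2X// phiT mul1e.
have fin2 (S : set (R * R)) : measurable S -> phi2 S \is a fin_num.
  by move=> mS; exact: product_probability_fin_num.
have gm := @generator_measurable _ X D.
pose gen := generator X D; pose TG := g_sigma_algebraType gen.
have indep2 C S : <<s gen >> C -> measurable S ->
    P (C `&` (fun w => (V1 w, V2 w)) @^-1` S) = (P C * phi2 S)%E.
  move=> GC mS; have mC := g_sigma_measurable gm GC.
  have PC : P C = (fine (P C))%:E by rewrite fineK// fin_num_measure.
  rewrite PC; apply: (@joint_law _ _ _ P _ _ _ _ phi phi) => //.
    exact: fine_ge0.
  by move=> A B mA mB; rewrite -PC; exact: indep.
have mV : measurable_fun [set: T] (fun w => (V1 w, V2 w)).
  exact: measurable_fun_pair.
(* The events [X a \in A] and [X b \in B] as sets of pairs of a frozen sample point and a value of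
   [(V1, V2)]. *)
pose SA (A : set R) : set (TG * (R * R)) :=
  [set q | A (Za q.1 + s * q.2.1)].
pose SB (B : set R) : set (TG * (R * R)) :=
  [set q | B (Zb q.1 + c * q.2.1 + t * q.2.2)].
have mSA A : measurable A -> measurable (SA A).
  move=> mA; rewrite -[X in measurable X]setTI.
  have mf : measurable_fun [set: TG * (R * R)] (fun q => Za q.1 + s * q.2.1).
    apply: measurable_funD; first exact: (measurableT_comp mZa measurable_fst).
    apply: measurable_funM => //.
    exact: (measurableT_comp measurable_fst measurable_snd).
  exact: mf.
have mSB B : measurable B -> measurable (SB B).
  move=> mB; rewrite -[X in measurable X]setTI.
  have mf : measurable_fun [set: TG * (R * R)]
      (fun q => Zb q.1 + c * q.2.1 + t * q.2.2).
    apply: measurable_funD; [apply: measurable_funD|].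
    - exact: (measurableT_comp mZb measurable_fst).
    - apply: measurable_funM => //.
      exact: (measurableT_comp measurable_fst measurable_snd).
    - apply: measurable_funM => //.
      exact: (measurableT_comp measurable_snd measurable_snd).
  exact: mf.
have kernel S mS := cond_prob_kernel (S := S)
  (nu := phi2 : probability _ R) gm mV indep2 mS.
have kerA A : measurable A -> is_cond_prob P <<s gen >> (X a @^-1` A)
    (fun w => fine (phi2 (xsection (SA A) w))).
  move=> mA; have := kernel (SA A) (mSA A mA).
  rewrite (_ : [set w | _] = X a @^-1` A)//.
  by apply/seteqP; split => w; rewrite /SA /= XaE.
have kerB B : measurable B -> is_cond_prob P <<s gen >> (X b @^-1` B)
    (fun w => fine (phi2 (xsection (SB B) w))).
  move=> mB; have := kernel (SB B) (mSB B mB).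
  rewrite (_ : [set w | _] = X b @^-1` B)//.
  by apply/seteqP; split => w; rewrite /SB /= XbE.
have kerAB A B : measurable A -> measurable B ->
    is_cond_prob P <<s gen >> (X a @^-1` A `&` X b @^-1` B)
    (fun w => fine (phi2 (xsection (SA A `&` SB B) w))).
  move=> mA mB.
  have := kernel (SA A `&` SB B) (measurableI _ _ (mSA A mA) (mSB B mB)).
  rewrite (_ : [set w | _] = X a @^-1` A `&` X b @^-1` B)//.
  by apply/seteqP; split => w; rewrite /SA /SB /= XaE XbE.
split=> [ci|c0].
  apply/eqP/negPn/negP => c0.
  (* The signs are chosen so that [V1] enters both inequalities with a positive coefficient,
     [s ^+ 2] and [c ^+ 2]. *)
  pose A := [set x : R | 0 < s * x]; pose B := [set x : R | 0 < c * x].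
  have mhalf (k : R) : measurable [set x : R | 0 < k * x].
    by apply: measurable_set_gt0; apply: measurable_funM.
  have mA : measurable A by exact: mhalf.
  have mB : measurable B by exact: mhalf.
  have [||p1 [p2 [p1A p2B p12]]] := ci (X a @^-1` A) (X b @^-1` B).
  - by apply/sigma_of_set1; exists A.
  - by apply/sigma_of_set1; exists B.
  have e1 := cond_prob_unique gm p1A (kerA A mA).
  have e2 := cond_prob_unique gm p2B (kerB B mB).
  have e12 := cond_prob_unique gm p12 (kerAB A B mA mB).
  have lt12 w :
      fine (phi2 (xsection (SA A) w)) * fine (phi2 (xsection (SB B) w)) <
      fine (phi2 (xsection (SA A `&` SB B) w)).
    pose u := s * Za w; pose v := c * Zb w.
    have mA' : measurable [set x : R | 0 < u + s ^+ 2 * x].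
      apply: measurable_set_gt0.
      by apply: measurable_funD => //; apply: measurable_funM.
    have xA : xsection (SA A) w = [set x | 0 < u + s ^+ 2 * x] `*` setT.
      apply/seteqP; split => -[x y];
        rewrite /xsection /SA /A /= inE/= mulrDr mulrA -expr2//.
      by case.
    have xB : xsection (SB B) w =
        [set e | 0 < v + c ^+ 2 * e.1 + (c * t) * e.2].
      by apply/seteqP; split => -[x y];
        rewrite /xsection /SB /B /= inE/= !mulrDr !mulrA -expr2.
    have xAB : xsection (SA A `&` SB B) w = [set e |
        0 < u + s ^+ 2 * e.1 /\ 0 < v + c ^+ 2 * e.1 + (c * t) * e.2].
      rewrite xsectionI xA xB; apply/seteqP; split => e /=; first by case=> -[].
      by case.
    have assoc :=
      normal_association u v (a := s ^+ 2) (b := c ^+ 2) (g := c * t).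
    have fine_lt (r1 r2 r3 : \bar R) : r1 \is a fin_num -> r2 \is a fin_num ->
        r3 \is a fin_num -> (r1 * r2 < r3)%E -> fine r1 * fine r2 < fine r3.
      by move=> f1 f2 f3; rewrite -lte_fin EFinM !fineK.
    apply: fine_lt.
    - by apply: fin2; apply: measurable_xsection; exact: mSA.
    - by apply: fin2; apply: measurable_xsection; exact: mSB.
    - apply: fin2; apply: measurable_xsection.
      by apply: measurableI; [exact: mSA|exact: mSB].
    rewrite xAB xA xB phi2XT//; apply: assoc; last exact: mulf_neq0.
      by rewrite exprn_even_gt0.
    by rewrite exprn_even_gt0.
  (* The factoring versions agree almost surely with the explicit ones, whereas the explicit ones
     violate the factorization at every point. *)
  have : {ae P, forall w : T, False}.
    have key (a1 a2 b1 b2 b12 : R) :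
        a1 = b1 -> a2 = b2 -> a1 * a2 = b12 -> b1 * b2 < b12 -> False.
      by move=> -> -> ->; rewrite ltxx.
    by apply: filterS3 e1 e2 e12 => w h1 h2 h12; exact: key h1 h2 h12 (lt12 w).
  move=> [N [mN N0 NE]].
  have NT : N = setT by apply/seteqP; split => // w _; apply: NE => /=; case.
  by move: N0; rewrite NT probability_setT => /eqP; rewrite onee_eq0.
move=> E1 E2 /sigma_of_set1[A mA ->] /sigma_of_set1[B mB ->].
exists (fun w => fine (phi2 (xsection (SA A) w))),
  (fun w => fine (phi2 (xsection (SB B) w))).
split; [exact: kerA|exact: kerB|].
rewrite (_ : (fun w => _) =
    (fun w => fine (phi2 (xsection (SA A `&` SB B) w)))).
  exact: kerAB.
apply/funext => w.
(* With [c = 0] the two sections depend on different coordinates, so their intersection is a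
   rectangle. *)
pose A' := [set x | A (Za w + s * x)]; pose B' := [set y | B (Zb w + t * y)].
have mA' : measurable A'.
  have mf : measurable_fun [set: R] (fun x => Za w + s * x).
    by apply: measurable_funD => //; apply: measurable_funM.
  by rewrite -[X in measurable X]setTI; apply: mf.
have mB' : measurable B'.
  have mf : measurable_fun [set: R] (fun x => Zb w + t * x).
    by apply: measurable_funD => //; apply: measurable_funM.
  by rewrite -[X in measurable X]setTI; apply: mf.
have xA : xsection (SA A) w = A' `*` setT.
  by apply/seteqP; split => -[x y]; rewrite /xsection /SA /= inE//; case.
have xB : xsection (SB B) w = setT `*` B'.
  apply/seteqP; split => -[x y];
    rewrite /xsection /SB /= inE/= c0 mul0r addr0//.
  by case.
rewrite xsectionI xA xB -setXI setIT setTI phi2XT// phi2TX// phi2X//.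
by rewrite fineM//; exact: (fin_num_measure phi).
Qed.

End CondIndep.

(** * Conditional independence in Gaussian vectors *)

Section Gaussian.
Context {d : measure_display} {T : measurableType d} {R : realType}.
Variable P : probability T R.
Local Notation phi := (@normal_prob R 0 1).

Lemma measurable_linear_comb d' (T' : measurableType d') k (u : 'I_k -> R)
    (v : 'I_k -> T' -> R) (Q : pred 'I_k) :
  (forall q, Q q -> measurable_fun setT (v q)) ->
  measurable_fun setT (fun w => \sum_(q | Q q) u q * v q w).
Proof.
move=> mv.
rewrite (_ : (fun w => _) = \sum_(q | Q q) (fun w => u q * v q w)); last first.
  by apply/funext => w; rewrite fct_sumE.
elim/big_ind : _ => [|f g mf mg|q Qq].
- exact: measurable_cst.
- exact: measurable_funD.
- by apply: measurable_funM => //; exact: mv.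
Qed.

(** Cylinders over the first [k] coordinates form a pi-system generating the sigma-algebra; on them
    the identity is the product rule. *)
Lemma std_normal_indep_prefix r k (v : 'I_r -> {RV P >-> R}) (i1 i2 : 'I_r)
    (C : set T) (A B : set R) :
  std_normal_vector v -> i1 != i2 -> (k <= i1)%N -> (k <= i2)%N ->
  sigma_of v [set q | (q < k)%N] C -> measurable A -> measurable B ->
  P (C `&` (v i1 @^-1` A `&` v i2 @^-1` B)) = (P C * (phi A * phi B))%E.
Proof.
move=> /std_normalP stdv i12 k1 k2 GC mA mB.
pose E := v i1 @^-1` A `&` v i2 @^-1` B.
have mE : measurable E by apply: measurableI; exact: measurable_funPTI.
pose gen2 : set (set T) := [set C | exists F : 'I_r -> set R,
  (forall q, measurable (F q)) /\
  C = \bigcap_(q in [set q : 'I_r | (q < k)%N]) v q @^-1` F q].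
have gen2m : gen2 `<=` measurable.
  move=> _ [F [mF ->]].
  apply: fin_bigcap_measurable; first exact: finite_finset.
  by move=> q _; exact: measurable_funPTI.
have phiT : phi [set: R] = 1%E by exact: (probability_setT (normal_prob 0 1)).
have PE : (phi A * phi B)%E = (fine (phi A) * fine (phi B))%:E.
  by rewrite EFinM !fineK//; exact: (fin_num_measure (normal_prob 0 1)).
have r0 : 0 <= fine (phi A) * fine (phi B) by rewrite mulr_ge0// fine_ge0.
have sub : sigma_of v [set q | (q < k)%N] `<=` <<s gen2 >>.
  apply: smallest_sub; first exact: smallest_sigma_algebra.
  move=> _ [q qk [F mF <-]]; apply: sub_sigma_algebra.
  exists (fun p => if p == q then F else setT); split => [p|].
    by case: ifP.
  rewrite setTI; apply/seteqP; split => [w Fw p pk|w /(_ q qk)].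
    by have [->|] := eqVneq p q.
  by rewrite eqxx.
rewrite PE muleC -/E.
rewrite -[LHS]/(mrestr P mE C) -[RHS]/(mscale (NngNum r0) P C).
apply: (@g_sigma_algebra_measure_unique _ _ _ gen2 gen2m (fun=> setT));
  last first.
- exact: sub.
- move=> _; rewrite -[ltLHS]/(P (setT `&` E)).
  by rewrite (le_lt_trans (probability_le1 _ _)) ?ltry// setTI.
- move=> _ [F [mF ->]].
  rewrite -[LHS]/(P (_ `&` E)) -[RHS]/(_%:E * P _)%E -PE.
  (* [H'] extends the cylinder by [setT]; [H] moreover prescribes [A] and [B] at [i1] and [i2],
     where [H'] imposes nothing. *)
  pose H' (q : 'I_r) := if (q < k)%N then F q else setT.
  pose H q := if q == i1 then A else if q == i2 then B else H' q.
  have mH' q : measurable (H' q) by rewrite /H'; case: ifP.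
  have mH q : measurable (H q) by rewrite /H; case: ifP => // _; case: ifP.
  have i21 : i2 != i1 by rewrite eq_sym.
  have H1 : H i1 = A by rewrite /H eqxx.
  have H2 : H i2 = B by rewrite /H (negbTE i21) eqxx.
  have H'1 : H' i1 = setT by rewrite /H' ltnNge k1.
  have H'2 : H' i2 = setT by rewrite /H' ltnNge k2.
  have HE q : q != i1 -> q != i2 -> H q = H' q.
    by rewrite /H => /negbTE -> /negbTE ->.
  have E1 : \bigcap_(q in [set q : 'I_r | (q < k)%N]) v q @^-1` F q =
      \bigcap_(q in setT) v q @^-1` H' q.
    apply/seteqP; split => [w Fw q _|w Fw q qk].
      by rewrite /H'; case: ifP => // qk; exact: Fw.
    by have := Fw q I; rewrite /H' qk.
  have E2 : \bigcap_(q in setT) v q @^-1` H' q `&` E =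
      \bigcap_(q in setT) v q @^-1` H q.
    apply/seteqP; split => [w [Fw [w1 w2]] q _|w Fw].
      have [->|q1] := eqVneq q i1; first by rewrite H1.
      have [->|q2] := eqVneq q i2; first by rewrite H2.
      by rewrite HE//; exact: Fw.
    split; last by split; [rewrite -H1|rewrite -H2]; exact: Fw.
    move=> q _; have [->|q1] := eqVneq q i1; first by rewrite H'1.
    have [->|q2] := eqVneq q i2; first by rewrite H'2.
    by rewrite -HE//; exact: Fw.
  rewrite E1 E2 !stdv// (bigD1 i1)//= (bigD1 i2)//= H1 H2.
  rewrite [in RHS](bigD1 i1)//= [in RHS](bigD1 i2)//= H'1 H'2.
  rewrite phiT !mul1e muleA; congr *%E.
  by apply: eq_bigr => q /andP[q1 q2]; rewrite HE.
- move=> _ _ [F [mF ->]] [F' [mF' ->]]; exists (fun q => F q `&` F' q); split.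
    by move=> q; exact: measurableI.
  by rewrite -bigcapI.
- by rewrite bigcup_const.
- by move=> _; exists (fun=> setT); split => //; rewrite bigcapT.
Qed.

Lemma measurable_generator (I : Type) (X : I -> {RV P >-> R}) (D : set I)
    (i : I) :
  D i -> measurable_fun [set: g_sigma_algebraType (generator X D)] (X i).
Proof.
move=> Di _ B mB; rewrite setTI; apply: sub_sigma_algebra.
by exists i => //; exists B => //; rewrite setTI.
Qed.

(** The variables are listed with [D] at positions below [k], then [a] at [k] and [b] at [k + 1].
    After the LQ decomposition both sides say that the entry of the triangular factor in row [b] and
    column [a] vanishes. *)
Lemma gaussian_cond_indep (I : Type) (X : I -> {RV P >-> R}) k r
    (f : 'I_k.+2 -> I) (B : 'M[R]_(k.+2, r)) (mu : 'I_k.+2 -> R)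
    (w : 'I_r -> {RV P >-> R}) (ia := widen_ord (leqnSn k.+1) ord_max) :
  std_normal_vector w ->
  (forall p om, X (f p) om = mu p + \sum_i B p i * w i om) ->
  B *m B^T \in unitmx ->
  cond_indep X [set f ia] [set f ord_max]
    (f @` [set p : 'I_k.+2 | (p < k)%N]) <->
  (forall x : 'rV[R]_k.+2, x 0 ord_max = 0 ->
     (forall p : 'I_k.+2, (p < k)%N -> (x *m (B *m B^T)) 0 p = 0) ->
     (x *m (B *m B^T)) 0 ord_max = 0).
Proof.
move=> stdw XE Bunit.
have [L [v [[stdv LE LB] L0]]] := std_normal_LQ B stdw.
(* A nonsingular Gram matrix of size [k + 2] needs at least that many noise variables; the columns
   of [L] beyond them are zero, so [M] carries all of [L]. *)
have kr : (k.+2 <= r)%N.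
  move: Bunit; rewrite -row_free_unit -row_leq_rank => /leq_trans; apply.
  by rewrite (leq_trans (mxrankM_maxl _ _))// rank_leq_col.
pose wd := widen_ord kr.
pose M := \matrix_(p, q) L p (wd q) : 'M[R]_k.+2.
have M0 (p q : 'I_k.+2) : (p < q)%N -> M p q = 0 by move=> pq; rewrite mxE L0.
have sumL (p : 'I_k.+2) (F : 'I_r -> R) :
    \sum_(i < r) L p i * F i = \sum_(q < k.+2) M p q * F (wd q).
  rewrite (bigID (fun i : 'I_r => (i < k.+2)%N))/= [X in _ + X]big1 ?addr0;
    last first.
    move=> i; rewrite -leqNgt => ki; rewrite L0 ?mul0r//.
    exact: leq_trans (ltn_ord p) ki.
  by rewrite (big_ord_narrow kr); apply: eq_bigr => q _; rewrite mxE.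
have MM : M *m M^T = B *m B^T.
  rewrite -LB; apply/matrixP => p q; rewrite !mxE.
  under [RHS]eq_bigr do rewrite mxE.
  by rewrite sumL; apply: eq_bigr => i _; rewrite !mxE.
have Mdiag (q : 'I_k.+2) : M q q != 0.
  have : \det M != 0.
    move: Bunit; rewrite -MM unitmxE det_mulmx det_tr unitfE.
    by apply: contraNneq => ->; rewrite mul0r.
  rewrite det_trig; last by apply/is_trig_mxP => i j; exact: M0.
  by move=> /prodf_neq0 /(_ q isT).
have XM p om : X (f p) om = mu p + \sum_(q < k.+2) M p q * v (wd q) om.
  by rewrite XE -LE sumL.
set D := f @` _.
have sumM p (F : 'I_k.+2 -> R) : \sum_(q < k.+2) M p q * F q =
   \sum_(q < k.+2 | (q < k)%N) M p q * F q +
   M p ia * F ia + M p ord_max * F ord_max.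
  rewrite (bigD1 ord_max)//= (bigD1 ia)/=; last by rewrite -val_eqE /= ltn_eqF.
  rewrite addrC [_ + \sum_(_ < _ | _) _]addrC; congr (_ + _ + _).
  apply: eq_bigl => q; rewrite -!val_eqE /=.
  have := ltn_ord q; rewrite ltnS leq_eqVlt => /orP[/eqP ->|qk].
    by rewrite eqxx ltnNge leqnSn.
  by rewrite (ltn_eqF qk)/= ltn_neqAle -ltnS qk andbT.
(* Forward substitution, with division by the nonzero diagonal entries, recovers the first [k] noise
   variables from those in [D]. *)
have mgen (q : 'I_k.+2) : (q < k)%N ->
    measurable_fun [set: g_sigma_algebraType (generator X D)] (v (wd q)).
  have [n] := ubnP (q : nat); elim: n q => // n IHn q; rewrite ltnS => qn qk.
  have -> : (v (wd q) : T -> R) = (fun om => (M q q)^-1 *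
      (X (f q) om - mu q - \sum_(i < k.+2 | (i < q)%N) M q i * v (wd i) om)).
    apply/funext => om; rewrite XM (bigID (fun i : 'I_k.+2 => (i < q)%N))/=.
    rewrite [X in _ + (_ + X)](bigD1 q) ?ltnn//=.
    rewrite [X in M q q * _ + X]big1 ?addr0; last first.
      move=> i /andP[]; rewrite -leqNgt leq_eqVlt eq_sym.
      move=> /orP[/eqP/val_inj ->|iq _].
        by rewrite eqxx.
      by rewrite M0// mul0r.
    by field; exact: Mdiag.
  apply: measurable_funM => //; apply: measurable_funB.
    apply: measurable_funB => //; apply: measurable_generator.
    by exists q.
  apply: measurable_linear_comb => i iq; apply: IHn.
    exact: leq_trans iq qn.
  exact: ltn_trans iq qk.
have subgen : sigma_of X D `<=` sigma_of v [set q | (q < k)%N].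
  apply: smallest_sub; first exact: smallest_sigma_algebra.
  move=> _ [_ [p pk <-] [F mF <-]].
  have mX : measurable_fun
      [set: g_sigma_algebraType (generator v [set q : 'I_r | (q < k)%N])]
      (X (f p)).
    have -> : (X (f p) : T -> R) = (fun om => mu p +
        \sum_(q < k.+2 | (q < k)%N) M p q * v (wd q) om).
      apply/funext => om; rewrite XM (sumM p (fun q => v (wd q) om)).
      rewrite (M0 p ia)// (M0 p ord_max) ?mul0r ?addr0//=.
      by rewrite (ltn_trans pk).
    apply: measurable_funD => //; apply: measurable_linear_comb => q qk.
    exact: measurable_generator.
  exact: mX.
(* The entries of [M] at [(a, a)], [(b, a)] and [(b, b)] serve as [s], [c] and [t]. *)
have decomp := @cond_indep_residuals _ _ _ P I X D (f ia) (f ord_max)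
  (fun om => mu ia + \sum_(q < k.+2 | (q < k)%N) M ia q * v (wd q) om)
  (fun om => mu ord_max + \sum_(q < k.+2 | (q < k)%N) M ord_max q * v (wd q) om)
  (v (wd ia)) (v (wd ord_max)) (M ia ia) (M ord_max ia) (M ord_max ord_max).
have ltmax (p : 'I_k.+2) : p != ord_max -> (p < k.+1)%N.
  by move=> pm; rewrite ltn_neqAle -ltnS ltn_ord andbT.
rewrite decomp//.
- rewrite -MM; split=> [c0 x xb x0|H].
    (* Triangularity makes [x *m M] vanish at the last position, because [x] does, and below [k], by
       forward substitution. Only its entry at [ia] remains, and this meets the zero entry of
       [M]. *)
    have xG p : (x *m (M *m M^T)) 0 p = \sum_q M p q * (x *m M) 0 q.
      by rewrite mulmxA mxE; apply: eq_bigr => q _; rewrite [M^T _ _]mxE mulrC.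
    have ymax : (x *m M) 0 ord_max = 0.
      rewrite mxE big1// => p _.
      have [->|pm] := eqVneq p ord_max; first by rewrite xb mul0r.
      by rewrite M0 ?mulr0//; exact: ltmax.
    have y0 (q : 'I_k.+2) : (q < k)%N -> (x *m M) 0 q = 0.
      have [n] := ubnP (q : nat); elim: n q => // n IHn q.
      rewrite ltnS => qn qk.
      have := x0 q qk; rewrite xG (bigD1 q)//= big1 ?addr0; last first.
        move=> i iq; have [iq'|] := ltnP i q.
          rewrite (IHn i) ?mulr0//; first exact: leq_trans qn.
          exact: ltn_trans qk.
        rewrite leq_eqVlt eq_sym val_eqE (negbTE iq)/= => qi.
        by rewrite M0// mul0r.
      by move=> /eqP; rewrite mulf_eq0 (negbTE (Mdiag q))/= => /eqP.
    rewrite xG sumM c0 mul0r ymax mulr0 !addr0 big1// => q qk.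
    by rewrite y0 ?mulr0.
  have Munit : M \in unitmx.
    rewrite unitmxE det_trig; last by apply/is_trig_mxP => i j; exact: M0.
    by rewrite unitfE; apply/prodf_neq0 => q _.
  (* For this [x], the vector [x *m (M *m M^T)] is column [ia] of [M]: zero on [D], and the wanted
     entry at [b]. *)
  pose x := delta_mx 0 ia *m invmx M : 'rV[R]_k.+2.
  have xM : x *m M = delta_mx 0 ia by rewrite /x mulmxKV.
  have xG p : (x *m (M *m M^T)) 0 p = M p ia.
    rewrite mulmxA xM mxE (bigD1 ia)//= big1 ?addr0.
      by rewrite !mxE !eqxx mul1r.
    by move=> i /negbTE iia; rewrite !mxE iia andbF mul0r.
  rewrite -(xG ord_max); apply: H => [|p pk].
    have : (x *m M) 0 ord_max = 0.
      by rewrite xM mxE -[_ == ia]val_eqE /= gtn_eqF.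
    rewrite mxE (bigD1 ord_max)//= big1 ?addr0.
      by move=> /eqP; rewrite mulf_eq0 (negbTE (Mdiag _)) orbF => /eqP.
    by move=> p pm; rewrite M0 ?mulr0//; exact: ltmax.
  by rewrite xG M0.
- apply: measurable_funD => //; apply: measurable_linear_comb => q.
  exact: mgen.
- apply: measurable_funD => //; apply: measurable_linear_comb => q.
  exact: mgen.
- move=> C E F GC mE mF; apply: (std_normal_indep_prefix (k := k)) => //=.
  + by rewrite -val_eqE /= ltn_eqF.
  + exact: subgen.
- move=> om; rewrite XM (sumM _ (fun q => v (wd q) om)).
  by rewrite (M0 ia ord_max)// mul0r addr0 addrA.
- by move=> om; rewrite XM (sumM _ (fun q => v (wd q) om)) !addrA.
Qed.

End Gaussian.

(** * Vanishing blocks of the inverse of a positive definite matrix *)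

Section LinearAlgebra.
Context {R : realType} {p : nat}.
Implicit Types (G : 'M[R]_p) (A D I J : {set 'I_p}).

Lemma posdefmx_eq0 G (u : 'rV[R]_p) :
  posdefmx G -> (u *m G *m u^T) 0 0 = 0 -> u = 0.
Proof.
move=> pG u0; apply/eqP/negPn/negP => /pG.
by rewrite u0 ltxx.
Qed.

Lemma unitmx_kernel G :
  (forall u : 'rV[R]_p, u *m G = 0 -> u = 0) -> G \in unitmx.
Proof.
move=> G0; rewrite -row_free_unit -kermx_eq0; apply/rowV0P => u.
by move=> /sub_kermxP; exact: G0.
Qed.

Lemma posdefmx_unit G : posdefmx G -> G \in unitmx.
Proof.
move=> pG; apply: unitmx_kernel => u uG.
by apply: (posdefmx_eq0 pG); rewrite uG mul0mx mxE.
Qed.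

(** After transposing a 1 x 1 matrix, the value is that of the form of [G] at [u *m invmx G]. *)
Lemma invmx_posdefmx_eq0 G (u : 'rV[R]_p) :
  posdefmx G -> (u *m invmx G *m u^T) 0 0 = 0 -> u = 0.
Proof.
move=> pG u0; have Gunit := posdefmx_unit pG.
have zG : u *m invmx G *m G = u by rewrite mulmxKV.
suff uG : u *m invmx G = 0 by rewrite -zG uG mul0mx.
apply: (posdefmx_eq0 pG); rewrite zG trmx_mul mulmxA.
have tr00 (A : 'M[R]_1) : A 0 0 = A^T 0 0 by rewrite mxE.
by rewrite tr00 !trmx_mul !trmxK mulmxA.
Qed.

Definition mask A : 'M[R]_p := \matrix_(i, j) ((i == j) && (i \in A))%:R.

Lemma mulmx_mask A (u : 'rV[R]_p) q :
  (u *m mask A) 0 q = if q \in A then u 0 q else 0.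
Proof.
rewrite mxE (bigD1 q)//= big1 ?addr0; last first.
  by move=> i /negbTE iq; rewrite mxE iq mulr0.
by rewrite mxE eqxx; case: ifP => _; rewrite ?mulr1 ?mulr0.
Qed.

Lemma tr_mask A : (mask A)^T = mask A.
Proof. by apply/matrixP => i j; rewrite !mxE eq_sym; case: eqP => // ->. Qed.

Lemma mulmx_maskP A (u : 'rV[R]_p) :
  u *m mask A = u <-> forall q, q \notin A -> u 0 q = 0.
Proof.
split=> [uA q qA|uA]; first by rewrite -uA mulmx_mask (negbTE qA).
by apply/rowP => q; rewrite mulmx_mask; case: ifPn => // /uA.
Qed.

(** The [D x D] block of [G] is invertible. To stay in the full space, it is completed by the
    identity on the complement of [D], which gives the invertible matrix [M]. *)
Lemma posdefmx_solve G D (t : 'rV[R]_p) : posdefmx G ->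
  exists u : 'rV[R]_p, (forall q, q \notin D -> u 0 q = 0) /\
    forall q, q \in D -> (u *m G) 0 q = t 0 q.
Proof.
move=> pG; set E := mask D.
have EE : E *m E = E.
  apply/row_matrixP => i; rewrite row_mul; apply/mulmx_maskP => q qD.
  by rewrite !mxE; case: eqP => [->|//]; rewrite (negbTE qD).
have EC : E *m (1%:M - E) = 0 by rewrite mulmxBr mulmx1 EE subrr.
have CE : (1%:M - E) *m (1%:M - E) = 1%:M - E.
  by rewrite mulmxBl mul1mx EC subr0.
pose M := E *m G *m E + (1%:M - E).
have ME (u : 'rV[R]_p) (s : 'rV[R]_p) : u *m M = s *m E ->
    u *m E = u /\ u *m G *m E = s *m E.
  move=> uM.
  have uC : u *m (1%:M - E) = 0.
    have /= := congr1 (mulmx^~ (1%:M - E)) uM.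
    by rewrite /M (mulmxDr u) mulmxDl -!mulmxA EC CE !mulmx0 add0r.
  have uE : u *m E = u.
    by apply/eqP; rewrite eq_sym -subr_eq0 -{1}[u]mulmx1 -mulmxBr uC.
  by split => //; move: uM; rewrite /M (mulmxDr u) uC addr0 !mulmxA uE.
have Munit : M \in unitmx.
  apply: unitmx_kernel => u uM.
  have [uE uGE] : u *m E = u /\ u *m G *m E = 0 *m E.
    by apply: ME; rewrite mul0mx.
  apply: (posdefmx_eq0 pG); rewrite -[in X in X^T]uE trmx_mul tr_mask mulmxA.
  by rewrite uGE !mul0mx mxE.
have [uE uGE] := ME (t *m E *m invmx M) t (mulmxKV Munit _).
exists (t *m E *m invmx M); split; first exact/mulmx_maskP.
move=> q qD; have := congr1 (fun u : 'rV[R]_p => u 0 q) uGE.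
by rewrite !mulmx_mask qD.
Qed.

(* For a covariance matrix [G], the hypotheses on [x] say that the corresponding
   combination of variables is, up to scaling, the residual of variable [a]
   after regression on the variables in [D]. *)
Definition partial_uncorrelated G D (a b : 'I_p) : Prop :=
  forall x : 'rV[R]_p, (forall q, q \notin D -> q != a -> x 0 q = 0) ->
    (forall q, q \in D -> (x *m G) 0 q = 0) -> (x *m G) 0 b = 0.

(** Both directions produce a vector on which a definite quadratic form vanishes, using the form of
    [G] in one and that of its inverse in the other. *)
Lemma partial_uncorrelated_blocks G I J : posdefmx G ->
  (forall q, q \in I -> q \notin J) ->
  (forall a b, a \in I -> b \in J ->
     partial_uncorrelated G (~: (I :|: J)) a b) <->
  (forall a b, a \in I -> b \in J -> invmx G a b = 0).
Proof.
move=> pG IJ; have Gunit := posdefmx_unit pG.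
have nIJ q : q \in I -> q \in J -> False.
  by move=> /IJ/negP.
split=> [H a b aI bJ|K0 a b aI bJ x xD xG].
  (* The residual of [a'] after regression on [D]. It is orthogonal to [D] by construction and to
     [J] by hypothesis. *)
  have res a' : exists r : 'rV[R]_p, a' \in I ->
     [/\ r 0 a' = 1, (forall q, q \in I :|: J -> q != a' -> r 0 q = 0) &
         forall q, q \notin I -> (r *m G) 0 q = 0].
    have [u [uD uG]] := posdefmx_solve (~: (I :|: J)) (- row a' G) pG.
    exists (delta_mx 0 a' + u) => a'I; split.
    - rewrite !mxE !eqxx uD ?addr0//.
      by rewrite !inE a'I.
    - move=> q qIJ /negbTE qa; rewrite !mxE qa eqxx uD ?addr0//.
      by rewrite inE qIJ.
    - have rD q : q \notin I :|: J -> ((delta_mx 0 a' + u) *m G) 0 q = 0.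
        move=> qIJ; rewrite mulmxDl -rowE !mxE.
        have := uG q; rewrite inE qIJ => /(_ isT); rewrite !mxE => ->.
        by rewrite subrr.
      move=> q qI; have [qIJ|] := boolP (q \in I :|: J); last exact: rD.
      have qJ : q \in J by move: qIJ; rewrite inE (negbTE qI).
      apply: (H a' q a'I qJ) => [s|s]; last by rewrite inE; exact: rD.
      rewrite inE negbK => sIJ /negbTE sa.
      by rewrite !mxE sa eqxx uD ?addr0// inE sIJ.
  have [r Hr] := choice res.
  pose x := row a (invmx G).
  have xG : x *m G = delta_mx 0 a by rewrite /x -row_mul mulVmx// row1.
  (* The combination of residuals that has the coordinates of [x] on [I]; its coordinates on [J] are
     zero. *)
  pose y := \sum_(a' in I) x 0 a' *: r a'.
  have yE q : q \in I :|: J -> y 0 q = if q \in I then x 0 q else 0.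
    move=> qIJ; rewrite /y summxE; case: ifPn => qI.
      rewrite (bigD1 q)//= big1 ?addr0.
        by rewrite mxE; have [-> _ _] := Hr q qI; rewrite mulr1.
      move=> s /andP[sI sq]; rewrite mxE; have [_ -> //] := Hr s sI.
        by rewrite mulr0.
      by rewrite eq_sym.
    rewrite big1// => s sI; rewrite mxE; have [_ -> //] := Hr s sI.
      by rewrite mulr0.
    by apply: contraNneq qI => ->.
  have yG q : q \notin I -> (y *m G) 0 q = 0.
    move=> qI; rewrite /y mulmx_suml summxE big1// => s sI.
    by rewrite -scalemxAl mxE; have [_ _ ->] := Hr s sI; rewrite ?mulr0.
  (* The difference vanishes on [I] and its product with [G] vanishes off [I], so the form of [G] is
     zero at it. *)
  have : x - y = 0.
    apply: (posdefmx_eq0 pG); rewrite mxE big1// => q _.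
    rewrite [_^T _ _]mxE; have [qI|qI] := boolP (q \in I).
      by rewrite [X in _ * X]mxE [(- y) _ _]mxE yE ?qI ?subrr ?mulr0// inE qI.
    rewrite mulmxBl xG [X in X * _]mxE [X in (_ + X) * _]mxE yG// mxE.
    have /negbTE -> : q != a by apply: contraNneq qI => ->.
    by rewrite andbF subr0 mul0r.
  move=> /subr0_eq xy.
  have : x 0 b = 0.
    rewrite xy yE; last by rewrite inE bJ orbT.
    by case: ifPn => // bI; case: (nIJ b).
  by rewrite mxE.
set y := x *m G.
have xE : x = y *m invmx G by rewrite /y mulmxK.
pose yJ := y *m mask J.
have yIJ : y = y *m mask I + yJ.
  apply/rowP => q; rewrite [RHS]mxE /yJ !mulmx_mask.
  case: ifPn => qI; case: ifPn => qJ; rewrite ?addr0 ?add0r//.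
    by case: (nIJ q).
  by apply: xG; rewrite !inE negb_or qI.
(* [x] vanishes on [J], so its product with [yJ] is zero; the part of [y] on [I] contributes
   nothing, since the [I x J] block of the inverse is zero. *)
have yJ0 : (yJ *m invmx G *m yJ^T) 0 0 = 0.
  have e1 : (x *m yJ^T) 0 0 = 0.
    rewrite mxE big1// => q _; rewrite [_^T _ _]mxE mulmx_mask.
    case: ifPn => qJ; last by rewrite mulr0.
    rewrite xD ?mul0r//; first by rewrite !inE qJ orbT.
    by apply/eqP => qa; apply: (nIJ q) => //; rewrite qa.
  have e2 : (y *m mask I *m invmx G *m yJ^T) 0 0 = 0.
    rewrite mxE big1// => q _; rewrite [_^T _ _]mxE mulmx_mask.
    case: ifPn => qJ; last by rewrite mulr0.
    rewrite mxE big1 ?mul0r// => s _; rewrite mulmx_mask.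
    by case: ifPn => sI; rewrite ?mul0r// K0// mulr0.
  move: e1; rewrite xE {1}yIJ !mulmxDl mxE e2 add0r.
  exact.
have := invmx_posdefmx_eq0 pG yJ0.
by move=> /rowP/(_ b); rewrite /yJ mulmx_mask bJ [RHS]mxE.
Qed.

End LinearAlgebra.

(** * Gram matrices and subfamilies of a Gaussian vector *)

Section GaussianVector.
Context {d : measure_display} {T : measurableType d} {R : realType}.
Variable P : probability T R.

Lemma covariance_sumr n (X : T -> R) (Y : 'I_n -> T -> R) (u : 'I_n -> R) :
  X \in Lfun P 2%:E -> (forall q, Y q \in Lfun P 2%:E) ->
  covariance P X (fun w => \sum_q u q * Y q w) =
  (\sum_q (u q)%:E * covariance P X (Y q))%E.
Proof.
move=> X2 Y2.
have finT : P setT \is a fin_num := fin_num_measure P _ measurableT.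
have L1 (Z : T -> R) : Z \in Lfun P 2%:E -> Z \in Lfun P 1.
  exact: Lfun_subset12.
rewrite (_ : (fun w => _) = \sum_q (u q \o* Y q)%R); last first.
  apply/funext => w; rewrite fct_sumE.
  by apply: eq_bigr => q _ /=; rewrite mulrC.
suff H (s : seq 'I_n) : \sum_(q <- s) (u q \o* Y q)%R \in Lfun P 2%:E /\
    covariance P X (\sum_(q <- s) (u q \o* Y q)%R) =
    (\sum_(q <- s) (u q)%:E * covariance P X (Y q))%E.
  exact: (H _).2.
have [L20 L2lin] : submod_closed (Lfun P 2%:E).
  by apply: Lfun_submod_closed; rewrite lee_fin ler1n.
have uYE q : (u q \o* Y q)%R = u q *: Y q.
  by apply/funext => w /=; rewrite mulrC.
have uY2 q : (u q \o* Y q)%R \in Lfun P 2%:E.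
  by rewrite uYE -[_ *: _]addr0; exact: L2lin.
elim: s => [|q s [IH1 IH2]].
  rewrite !big_nil; split => //; exact: covariance_cst_r.
rewrite !big_cons; split; first by rewrite uYE; exact: L2lin.
rewrite covarianceDr// IH2 covarianceZr//; [exact: L1|exact: L1|].
exact: Lfun2_mul_Lfun1.
Qed.

(** If [u *m B = 0], the combination of [v] with coefficients [u] is constant, hence uncorrelated
    with every [v p], which contradicts definiteness of the covariance matrix. From here on
    [B *m B^T] takes the role of that matrix. *)
Lemma gram_posdefmx n r (v : 'rV[{RV P >-> R}]_n) (w : 'I_r -> {RV P >-> R})
    (B : 'M[R]_(n, r)) (mu : 'rV[R]_n) :
  (forall p, (v 0 p : T -> R) \in Lfun P 2%:E) ->
  (forall p om, v 0 p om = mu 0 p + \sum_(i < r) B p i * w i om) ->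
  posdefmx (covmx v) -> posdefmx (B *m B^T).
Proof.
move=> v2 vE pv u u0.
have -> : (u *m (B *m B^T) *m u^T) 0 0 = \sum_i (u *m B) 0 i ^+ 2.
  rewrite mulmxA -mulmxA -trmx_mul mxE; apply: eq_bigr => i _.
  by rewrite [_^T _ _]mxE expr2.
rewrite lt_neqAle sumr_ge0 ?andbT; last by move=> i _; exact: sqr_ge0.
apply/negP => /eqP/esym/psumr_eq0P uB.
have {}uB i : (u *m B) 0 i = 0.
  by apply/eqP; rewrite -sqrf_eq0; apply/eqP/uB => // j _; exact: sqr_ge0.
have := pv u u0; rewrite -mulmxA mxE big1 ?ltxx// => p _.
rewrite [X in _ * X](_ : _ = 0) ?mulr0//.
have cst0 : (fun om => \sum_q u 0 q * v 0 q om) = cst (\sum_q u 0 q * mu 0 q).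
  apply/funext => om /=.
  under eq_bigr do rewrite vE mulrDr.
  rewrite big_split /= [X in _ + X](_ : _ = 0) ?addr0//.
  under eq_bigr do rewrite mulr_sumr.
  rewrite exchange_big/= big1// => i _.
  under eq_bigr do rewrite mulrA.
  by rewrite -mulr_suml; have := uB i; rewrite mxE => ->; rewrite mul0r.
have := covariance_sumr (fun q => u 0 q) (v2 p) v2.
rewrite cst0 covariance_cst_r => /(congr1 fine) /= sum0.
rewrite mxE [RHS]sum0.
have finT : P setT \is a fin_num := fin_num_measure P _ measurableT.
have covfin q : covariance P (v 0 p) (v 0 q) \is a fin_num.
  by rewrite covariance_fin_num ?Lfun2_mul_Lfun1//; exact: Lfun_subset12.
rewrite -sum_fine => [|q _]; last by rewrite fin_numM.
by apply: eq_bigr => q _; rewrite !mxE fineM// mulrC.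
Qed.

(** Transports [gaussian_cond_indep] along an enumeration of [D], [a] and [b]. The Gram matrix of
    the subfamily is a principal submatrix of [B *m B^T], and vectors on it correspond to vectors
    supported on [D], [a] and [b]. *)
Lemma gaussian_cond_indep_partial n r (V : 'I_n -> {RV P >-> R})
    (w : 'I_r -> {RV P >-> R}) (B : 'M[R]_(n, r)) (mu : 'I_n -> R)
    (D : {set 'I_n}) (a b : 'I_n) :
  std_normal_vector w ->
  (forall p om, V p om = mu p + \sum_(i < r) B p i * w i om) ->
  posdefmx (B *m B^T) -> a != b -> a \notin D -> b \notin D ->
  cond_indep V [set a] [set b] [set q | q \in D] <->
  partial_uncorrelated (B *m B^T) D a b.
Proof.
move=> stdw VE pB ab aD bD.
pose s := enum D ++ [:: a; b].
pose k := #|D|.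
have ss : size s = k.+2 by rewrite size_cat /= addn2 -cardE.
have us : uniq s.
  by rewrite cat_uniq enum_uniq /= !mem_enum (negbTE aD) (negbTE bD)/= inE ab.
pose f (p : 'I_k.+2) := nth a s p.
have f_inj : injective f.
  move=> p q /eqP; rewrite nth_uniq ?ss// => /eqP; exact: val_inj.
have fa : f (widen_ord (leqnSn k.+1) ord_max) = a.
  by rewrite /f /s nth_cat /= -cardE ltnn subnn.
have fb : f ord_max = b.
  by rewrite /f /s nth_cat /= -cardE ltnNge leqnSn subSnn.
have fD (p : 'I_k.+2) : (p < k)%N -> f p \in D.
  by move=> pk; rewrite /f /s nth_cat -cardE pk -mem_enum mem_nth// -cardE.
have Df q : q \in D -> exists2 p : 'I_k.+2, (p < k)%N & f p = q.
  move=> qD; have qk : (index q (enum D) < k)%N.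
    by rewrite /k cardE index_mem mem_enum.
  exists (Ordinal (ltn_trans qk (ltnW (ltnSn k.+1)))) => //.
  by rewrite /f /s nth_cat /= -cardE qk nth_index// mem_enum.
have DE : f @` [set p : 'I_k.+2 | (p < k)%N] = [set q | q \in D].
  apply/seteqP; split => [_ [p pk <-]|q /Df[p pk <-]]; first exact: fD.
  by exists p.
(* Selection matrix: left multiplication picks the rows in the order of [f], and [x *m F] extends
   [x] by zero. *)
pose F := \matrix_(p, q) (f p == q)%:R : 'M[R]_(k.+2, n).
have FE m (C : 'M[R]_(n, m)) p i : (F *m C) p i = C (f p) i.
  rewrite mxE (bigD1 (f p))//= big1 ?addr0; last first.
    by move=> q /negbTE qp; rewrite mxE eq_sym qp mul0r.
  by rewrite mxE eqxx mul1r.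
have FTE (y : 'rV[R]_n) p : (y *m F^T) 0 p = y 0 (f p).
  by rewrite -[y *m F^T]trmxK mxE trmx_mul trmxK FE mxE.
have xF (x : 'rV[R]_k.+2) p : (x *m F) 0 (f p) = x 0 p.
  rewrite mxE (bigD1 p)//= big1 ?addr0.
    by rewrite mxE eqxx mulr1.
  by move=> q qp; rewrite mxE (inj_eq f_inj) (negbTE qp) mulr0.
have xF0 (x : 'rV[R]_k.+2) q : (forall p, f p != q) -> (x *m F) 0 q = 0.
  by move=> fq; rewrite mxE big1// => p _; rewrite mxE (negbTE (fq p)) mulr0.
have gram : (F *m B) *m (F *m B)^T = F *m (B *m B^T) *m F^T.
  by rewrite trmx_mul !mulmxA.
have Funit : (F *m B) *m (F *m B)^T \in unitmx.
  apply: unitmx_kernel => u; rewrite gram => uG.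
  have : u *m F = 0.
    apply: (posdefmx_eq0 pB); rewrite trmx_mul -!mulmxA.
    by move: uG; rewrite !mulmxA => ->; rewrite mul0mx mxE.
  by move=> uF; apply/rowP => p; rewrite -xF uF !mxE.
have VfE p om : V (f p) om = mu (f p) + \sum_i (F *m B) p i * w i om.
  by rewrite VE; congr (_ + _); apply: eq_bigr => i _; rewrite FE.
have := gaussian_cond_indep stdw VfE Funit.
rewrite fa fb DE => ->; rewrite gram.
have xG (x : 'rV[R]_k.+2) p :
    (x *m (F *m (B *m B^T) *m F^T)) 0 p = (x *m F *m (B *m B^T)) 0 (f p).
  by rewrite -FTE !mulmxA.
split=> [H x xD xG0|H x xb xG0]; last first.
  rewrite xG fb; apply: H => [q qD qa|q /Df[p pk <-]].
    have [->|qb] := eqVneq q b; first by rewrite -fb xF.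
    apply: xF0 => p; apply/negP => /eqP fpq.
    have := ltn_ord p; rewrite ltnS leq_eqVlt => /orP[/eqP pk|].
      by case/eqP: qb; rewrite -fpq -fb; congr f; exact: val_inj.
    rewrite ltnS leq_eqVlt => /orP[/eqP pk|/fD]; last first.
      by rewrite fpq (negbTE qD).
    by case/eqP: qa; rewrite -fpq -fa; congr f; exact: val_inj.
  by rewrite -xG xG0.
have xE : (x *m F^T) *m F = x.
  apply/rowP => q; have [[p <-]|] := pselect (exists p, f p = q).
    by rewrite xF FTE.
  move=> nq; rewrite xF0; last first.
    by move=> p; apply/eqP => fp; apply: nq; exists p.
  rewrite xD//; first by apply/negP => /Df[p _ fp]; apply: nq; exists p.
  by apply/eqP => qa; apply: nq; rewrite qa -fa; eexists.
have := H (x *m F^T); rewrite !xG xE fb; apply.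
  by rewrite FTE fb xD// eq_sym.
by move=> p pk; rewrite xG xE; apply: xG0; exact: fD.
Qed.

End GaussianVector.

(** * The stacked process *)

Section Final.
Context {d : measure_display} {T : measurableType d} {R : realType}.
Variable P : probability T R.

Lemma sigma_of_image (I J : Type) (X : I -> {RV P >-> R})
    (V : J -> {RV P >-> R}) (h : I -> J) (D : set I) :
  (forall i, X i = V (h i)) -> sigma_of X D = sigma_of V (h @` D).
Proof.
move=> XV; rewrite /sigma_of bigcup_image.
by congr (<<s _ >>); apply: eq_bigcupr => i _; rewrite XV.
Qed.

Lemma cond_indep_image (I J : Type) (X : I -> {RV P >-> R})
    (V : J -> {RV P >-> R}) (h : I -> J) (D1 D2 D : set I) :
  (forall i, X i = V (h i)) ->
  cond_indep X D1 D2 D <-> cond_indep V (h @` D1) (h @` D2) (h @` D).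
Proof.
by move=> XV; rewrite /cond_indep !(sigma_of_image _ XV).
Qed.

Section StackIndex.
Variables (m l N : nat).

Definition stack_index (k : ('I_m + 'I_l) * 'I_N) : 'I_(N * m + N * l) :=
  match k with
  | (inl i, t) => lshift _ (mxvec_index t i)
  | (inr j, t) => rshift _ (mxvec_index t j)
  end.

Lemma mxvec_index_inj n1 n2 (t t' : 'I_n1) (i i' : 'I_n2) :
  mxvec_index t i = mxvec_index t' i' -> t = t' /\ i = i'.
Proof.
by move=> /cast_ord_inj/enum_rank_inj [-> ->].
Qed.

Lemma stack_index_inj : injective stack_index.
Proof.
move=> [[i|j] t] [[i'|j'] t'] /=.
- by move=> /lshift_inj/mxvec_index_inj[-> ->].
- by move=> /eqP; rewrite eq_lrshift.
- by move=> /eqP; rewrite eq_rlshift.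
- by move=> /rshift_inj/mxvec_index_inj[-> ->].
Qed.

Lemma stack_index_surj q : exists k, stack_index k = q.
Proof.
rewrite -(fintype.splitK q); case: (fintype.split q) => s /=.
  by case/mxvec_indexP: s => t i; exists (inl i, t).
by case/mxvec_indexP: s => t j; exists (inr j, t).
Qed.

Lemma stack2E (y : 'I_m -> 'I_N -> {RV P >-> R})
    (x : 'I_l -> 'I_N -> {RV P >-> R}) k :
  joint y x k.1 k.2 = stack2 y x 0 (stack_index k).
Proof.
case: k => -[i|j] t /=; rewrite /stack2 ?row_mxEl ?row_mxEr /stack mxvecE mxE//.
Qed.

End StackIndex.

End Final.

Theorem proposition2 (R : realType) (d : measure_display)
  (T : measurableType d) (P : probability T R) (m l n N : nat)
  (m_gt0 : (0 < m)%N) (l_gt0 : (0 < l)%N) (n_gt0 : (0 < n)%N)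
  (N_gt0 : (0 < N)%N) (N_even : ~~ odd N) (N_gt2n : (2 * n < N)%N)
  (y : 'I_m -> 'I_N -> {RV P >-> R}) (x : 'I_l -> 'I_N -> {RV P >-> R})
  (Omega : {set 'I_m * 'I_m})
  (z_gaussian : gaussian_vector (stack2 y x))
  (z_mean0 : forall c t, ('E_P[joint y x c t] = 0)%E)
  (z_stationary : stationary_periodic (joint y x))
  (z_reciprocal : reciprocal n (joint y x))
  (z_posdef : posdefmx (covmx (stack2 y x)))
  (S_circ : sym_banded_circ n (Sblock (covmx (stack2 y x))))
  (L_circ : sym_banded_circ n (Lblock (covmx (stack2 y x))))
  (Omega_diag : forall i, (i, i) \in Omega) :
  (forall (t1 t2 : 'I_N) (i j : 'I_m), (i, j) \notin Omega ->
     cond_indep (fun k : ('I_m + 'I_l) * 'I_N => joint y x k.1 k.2)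
       [set (inl i, t1)] [set (inl j, t2)] (all_but_points i j t1 t2))
  <->
  (forall (t1 t2 : 'I_N) (i j : 'I_m), (i, j) \notin Omega ->
     cond_indep (fun k : ('I_m + 'I_l) * 'I_N => joint y x k.1 k.2)
       [set (inl i, t1)] [set (inl j, t2)] (all_but_components i j)).
Proof.
have [r [w [B [mu [stdw vE]]]]] := z_gaussian.
have [u [uz _ [u2 _ _]]] := z_stationary.
have [h [h_inj h_surj hE]] :
    exists h : ('I_m + 'I_l) * 'I_N -> 'I_(N * m + N * l),
    [/\ injective h, forall q, exists k, h k = q &
        forall k, joint y x k.1 k.2 = stack2 y x 0 (h k)].
  exists (@stack_index m l N); split.
  - exact: stack_index_inj.
  - exact: stack_index_surj.
  - exact: stack2E.
(* Square integrability comes from wide-sense stationarity of the periodic extension. *)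
have v2 p : (stack2 y x 0 p : T -> R) \in Lfun P 2%:E.
  have [k <-] := h_surj p; rewrite -hE -uz; exact: u2.
have pG := gram_posdefmx v2 vE z_posdef.
set G := B *m B^T in pG.
(* Translation to positions in the stacked vector, whenever the conditioning set is everything
   outside [I] and [J]. *)
have ci (a b : ('I_m + 'I_l) * 'I_N) (I J : {set 'I_(N * m + N * l)})
    (D : set _) :
    h a \in I -> h b \in J -> h a != h b ->
    D = [set k | h k \notin I :|: J] ->
    cond_indep (fun k : ('I_m + 'I_l) * 'I_N => joint y x k.1 k.2)
       [set a] [set b] D <-> partial_uncorrelated G (~: (I :|: J)) (h a) (h b).
  move=> aI bJ ab DE.
  rewrite (cond_indep_image _ _ _ hE) !image_set1.
  rewrite (_ : _ @` D = [set q | q \in ~: (I :|: J)]); last first.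
    apply/seteqP; split => [_ [k Dk <-]|q].
      by move: Dk; rewrite DE /= !inE.
    by have [k <-] := h_surj q; rewrite /= inE => hk; exists k; rewrite ?DE.
  by apply: (gaussian_cond_indep_partial stdw vE pG) => //;
    rewrite !inE negbK ?aI ?bJ ?orbT.
have IJne i j t1 t2 : i != j -> h (inl i, t1) != h (inl j, t2).
  by move=> /eqP ij; apply/eqP => /h_inj [].
have points i j t1 t2 : i != j ->
    cond_indep (fun k : ('I_m + 'I_l) * 'I_N => joint y x k.1 k.2)
       [set (inl i, t1)] [set (inl j, t2)] (all_but_points i j t1 t2) <->
    invmx G (h (inl i, t1)) (h (inl j, t2)) = 0.
  move=> ij.
  (* Here the two blocks are single variables, so a single entry of the inverse is tested. *)
  pose I := [set h (inl i, t1)]%SET; pose J := [set h (inl j, t2)]%SET.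
  have blocks : (forall a b, a \in I -> b \in J ->
      partial_uncorrelated G (~: (I :|: J)) a b) <->
    (forall a b, a \in I -> b \in J -> invmx G a b = 0).
    apply: partial_uncorrelated_blocks => // q; rewrite !inE => /eqP ->.
    exact: IJne.
  have inIJ k : (h k \in I :|: J) = (k == (inl i, t1)) || (k == (inl j, t2)).
    by rewrite !inE !(inj_eq h_inj).
  rewrite (@ci _ _ I J) ?inE//; last 2 first.
  - exact: IJne.
  - rewrite predeqE => k.
    rewrite -[X in _ <-> X]/(is_true (h k \notin I :|: J)) inIJ.
    case: k => -[c|c] s //=.
    rewrite negb_or !xpair_eqE.
    rewrite -[inl c == inl i]/(c == i) -[inl c == inl j]/(c == j).
    split=> [[[/eqP/negbTE -> /eqP/negbTE ->]//|[-> /eqP st]|[-> /eqP st]]|].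
    + by rewrite (negbTE ij) andbT eqxx.
    + by rewrite eqxx [j == i]eq_sym (negbTE ij).
    have [->|ci_] := eqVneq c i.
      by rewrite /= => /andP[/eqP st _]; apply: Or32.
    have [->|cj] := eqVneq c j.
      by rewrite /= => /eqP st; apply: Or33.
    by move=> _; apply: Or31; split; apply/eqP.
  split=> [H|H].
    by apply: blocks.1; rewrite ?inE// => a b; rewrite !inE => /eqP -> /eqP ->.
  by apply: blocks.2; rewrite ?inE// => a b; rewrite !inE => /eqP -> /eqP ->.
have comps i j : i != j ->
    (forall t1 t2,
       cond_indep (fun k : ('I_m + 'I_l) * 'I_N => joint y x k.1 k.2)
       [set (inl i, t1)] [set (inl j, t2)] (all_but_components i j)) <->
    (forall t1 t2, invmx G (h (inl i, t1)) (h (inl j, t2)) = 0).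
  move=> ij.
  (* Here the blocks are the whole component processes, so the equivalence holds only for all pairs
     of times taken together. *)
  pose I := [set h (inl i, t) | t : 'I_N]%SET.
  pose J := [set h (inl j, t) | t : 'I_N]%SET.
  have hI t : h (inl i, t) \in I by apply/imsetP; exists t.
  have hJ t : h (inl j, t) \in J by apply/imsetP; exists t.
  have blocks : (forall a b, a \in I -> b \in J ->
      partial_uncorrelated G (~: (I :|: J)) a b) <->
    (forall a b, a \in I -> b \in J -> invmx G a b = 0).
    apply: partial_uncorrelated_blocks => // q /imsetP[t _ ->].
    by apply/imsetP => -[t' _ /eqP]; apply/negP; exact: IJne.
  have ci' t1 t2 := @ci (inl i, t1) (inl j, t2) I J (all_but_components i j)
    (hI t1) (hJ t2) (IJne i j t1 t2 ij).
  have DE : all_but_components i j = [set k | h k \notin I :|: J].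
    apply/seteqP; split => -[[c|c] s] /=; rewrite inE negb_or.
    - move=> [ci_ cj]; apply/andP; split; apply/imsetP => -[t _ /h_inj []].
        by move=> /ci_.
      by move=> /cj.
    - by move=> _; apply/andP; split; apply/imsetP => -[t _ /h_inj].
    - move=> /andP[cI cJ]; split => [ci_|cj].
        by move: cI; rewrite ci_ hI.
      by move: cJ; rewrite cj hJ.
    - by [].
  split=> [H t1 t2|H t1 t2].
    apply: blocks.1 => // _ _ /imsetP[t _ ->] /imsetP[t' _ ->].
    exact: (ci' t t' DE).1.
  apply: (ci' t1 t2 DE).2.
  apply: blocks.2 => // _ _ /imsetP[t _ ->] /imsetP[t' _ ->].
  exact: H.
(* Since [Omega] contains the diagonal, pairs outside it have distinct components, which makes the
   blocks disjoint. *)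
have Omega_ne i j : (i, j) \notin Omega -> i != j.
  by apply: contraNneq => ->.
split=> H t1 t2 i j ijO; have ij := Omega_ne i j ijO.
  by apply: (comps i j ij).2 => s1 s2; apply: (points i j s1 s2 ij).1; exact: H.
apply: (points i j t1 t2 ij).2.
by apply: (comps i j ij).1 => s1 s2; exact: H.
Qed.
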